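(* Let $A$ be an abelian group. Consider the diagram with rows $$0\to H^3_s(A,\mathbb{R}/\mathbb{Z})\to H^3_{ab}(A,\mathbb{R}/\mathbb{Z})\xrightarrow{b}\mathrm{Hom}(S^2(A),\mathbb{R}/\mathbb{Z})\to 0,$$ $$0\to\mathrm{Hom}(A,\tfrac12\mathbb{Z}/\mathbb{Z})\to\mathrm{Quad}(A,\mathbb{R}/\mathbb{Z})\xrightarrow{b}\mathrm{Hom}(S^2(A),\mathbb{R}/\mathbb{Z})\to 0,$$ in which the unlabeled maps between nonzero groups are the inclusions, and with vertical maps from the first row to the second given by $\mathrm{Tr}:H^3_s(A,\mathbb{R}/\mathbb{Z})\to\mathrm{Hom}(A,\frac12\mathbb{Z}/\mathbb{Z})$, $\mathrm{Tr}:H^3_{ab}(A,\mathbb{R}/\mathbb{Z})\to\mathrm{Quad}(A,\mathbb{R}/\mathbb{Z})$ and the identity of $\mathrm{Hom}(S^2(A),\mathbb{R}/\mathbb{Z})$. Then the diagram commutes, the vertical morphisms are isomorphisms, and the horizontal sequences are exact.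
   Context: Groups are written additively. For abelian groups $A,N$, $Z^3_{ab}(A,N)$ is the group of pairs $(\omega,c)$ of maps $\omega:A^3\to N$, $c:A\times A\to N$ such that for all $x,y,z,t\in A$: (i) $\omega(y,z,t)-\omega(x+y,z,t)+\omega(x,y+z,t)-\omega(x,y,z+t)+\omega(x,y,z)=0$; (ii) $c(x,z)-c(x,y+z)+c(x,y)+\omega(x,y,z)-\omega(y,x,z)+\omega(y,z,x)=0$; (iii) $c(y,z)-c(x+y,z)+c(x,z)-\omega(x,y,z)+\omega(x,z,y)-\omega(z,x,y)=0$. $B^3_{ab}(A,N)$ is the subgroup of pairs $(\omega_f,c_f)$, $f:A\times A\to N$ any map, where $\omega_f(x,y,z)=f(y,z)-f(x+y,z)+f(x,y+z)-f(x,y)$ and $c_f(x,y)=f(x,y)-f(y,x)$. $H^3_{ab}(A,N)=Z^3_{ab}(A,N)/B^3_{ab}(A,N)$. A quadratic form from $A$ to $N$ is a function $\gamma:A\to N$ with $\gamma(a)=\gamma(-a)$ and $\gamma(a+b+c)-\gamma(b+c)-\gamma(a+c)-\gamma(a+b)+\gamma(a)+\gamma(b)+\gamma(c)=0$ for all $a,b,c\in A$; $\mathrm{Quad}(A,N)$ is the group of these. $\mathrm{Tr}$ sends the class of $(\omega,c)$ to the quadratic form $a\mapsto c(a,a)$; by a theorem of Eilenberg and MacLane, $\mathrm{Tr}:H^3_{ab}(A,N)\to\mathrm{Quad}(A,N)$ is a group isomorphism. For a quadratic form $q$, $b_q(a_1,a_2)=q(a_1+a_2)-q(a_1)-q(a_2)$,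 a symmetric bilinear form, viewed as an element of $\mathrm{Hom}(S^2(A),N)$, where $S^2(A)$ is the second symmetric power over $\mathbb{Z}$. The map $b$ on $\mathrm{Quad}(A,\mathbb{R}/\mathbb{Z})$ is $q\mapsto b_q$; the map $b$ on $H^3_{ab}(A,\mathbb{R}/\mathbb{Z})$ sends the class of $(\omega,c)$ to $b_q$ with $q(a)=c(a,a)$. $H^3_s(A,\mathbb{R}/\mathbb{Z})\subset H^3_{ab}(A,\mathbb{R}/\mathbb{Z})$ is the subgroup of classes of symmetric abelian 3-cocycles, i.e. those whose $b_q$ is trivial. *)

(* Defs.v *)
From HB Require Import structures.
From mathcomp Require Import all_boot all_order all_algebra.
From mathcomp Require Import ring_quotient freeg.
From mathcomp Require Import boolp classical_sets functions reals.

Set Implicit Arguments.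
Unset Strict Implicit.
Unset Printing Implicit Defensive.

Import GRing.Theory Num.Theory.

Local Open Scope ring_scope.
Local Open Scope quotient_scope.

Notation "{ 'quot' I }" := (@Quotient.quot _ I) : type_scope.

(* Equality and choice on homomorphisms are classical. *)
Section HomGroup.
Variables (U V : zmodType).
Implicit Types f g h : {additive U -> V}.

HB.instance Definition _ := gen_eqMixin {additive U -> V}.
HB.instance Definition _ := gen_choiceMixin {additive U -> V}.

Lemma hom_ext f g : f =1 g -> f = g.
Proof.
case: f g => [f [[mf]]] [g [[mg]]] /= fg.
have efg : f = g by apply/funext.
by case: _ / efg mg {fg} => mg; rewrite (Prop_irrelevance mf mg).
Qed.

Definition hom_zero : {additive U -> V} := \0.
Definition hom_opp f : {additive U -> V} := \- f.
Definition hom_add f g : {additive U -> V} := f \+ g.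

Lemma hom_addA : associative hom_add.
Proof. by move=> f g h; apply: hom_ext => x /=; rewrite addrA. Qed.
Lemma hom_addC : commutative hom_add.
Proof. by move=> f g; apply: hom_ext => x /=; rewrite addrC. Qed.
Lemma hom_add0 : left_id hom_zero hom_add.
Proof. by move=> f; apply: hom_ext => x /=; rewrite add0r. Qed.
Lemma hom_addN : left_inverse hom_zero hom_opp hom_add.
Proof. by move=> f; apply: hom_ext => x /=; rewrite addNr. Qed.

HB.instance Definition _ :=
  GRing.isZmodule.Build {additive U -> V} hom_addA hom_addC hom_add0 hom_addN.

Lemma hom0E (x : U) : (0 : {additive U -> V}) x = 0. Proof. by []. Qed.
Lemma homDE f g x : (f + g) x = f x + g x. Proof. by []. Qed.
Lemma homNE f x : (- f) x = - f x. Proof. by []. Qed.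
Lemma homBE f g x : (f - g) x = f x - g x. Proof. by []. Qed.
End HomGroup.

Lemma eq0_via (V : zmodType) (s t u : V) :
  s = 0 -> t = 0 -> u - (s - t) = 0 -> u = 0.
Proof. by move=> -> ->; rewrite !subr0. Qed.

(* zmod_cancel proves s = 0 for a signed sum s whose terms cancel in pairs. *)
Ltac move_last u :=
  repeat match goal with
  | |- context [@GRing.add _ ?y ?z] =>
      match y with @GRing.add _ ?x ?v =>
        unify u v; assert_fails (unify u z); rewrite (addrAC x v z)
      end
  end.

Ltac zmod_cancel :=
  rewrite ?(opprD, opprK, opprB) ?addrA;
  match goal with |- @eq _ ?s _ => rewrite -[s]add0r end;
  rewrite ?addrA;
  repeat match goal with
  | |- @eq _ (@GRing.add _ _ ?t) _ =>
      lazymatch t with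
      | @GRing.opp _ ?u => move_last u; rewrite subrK
      | _ => move_last (- t); rewrite addrK
      end
  end.

Section QuotientLift.
Variables (V W : zmodType) (I : zmodClosed V) (f : {additive V -> W}).
Hypothesis f0 : forall x, x \in I -> f x = 0.

Definition quot_fun (x : {quot I}) : W := f (repr x).

Lemma quot_funE (x : V) : quot_fun (\pi_{quot I} x) = f x.
Proof.
apply/eqP; rewrite -subr_eq0 -raddfB f0 //.
by rewrite Quotient.idealrBE reprK.
Qed.

Lemma quot_fun_is_zmod_morphism : zmod_morphism quot_fun.
Proof.
elim/quotW => x; elim/quotW => y.
by rewrite -raddfB !quot_funE raddfB.
Qed.

Definition quot_lift : {additive {quot I} -> W} :=
  HB.pack quot_fun
    (GRing.isZmodMorphism.Build _ _ quot_fun quot_fun_is_zmod_morphism).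

Lemma quot_liftE (x : V) : quot_lift (\pi_{quot I} x) = f x.
Proof. exact: quot_funE. Qed.
End QuotientLift.

Section Generated.
Variables (V : zmodType) (S : set V).

Definition gen_sub : {pred V} := fun x =>
  `[< forall I : zmodClosed V, (forall s, S s -> s \in I) -> x \in I >].

Lemma gen_sub_closed : zmod_closed gen_sub.
Proof.
split; first by apply/asboolP => I _; exact: rpred0.
move=> x y /asboolP hx /asboolP hy; apply/asboolP => I SI.
by apply: rpredB; [exact: hx | exact: hy].
Qed.

HB.instance Definition _ := GRing.isZmodClosed.Build V gen_sub gen_sub_closed.

Lemma mem_gen s : S s -> s \in gen_sub.
Proof. by move=> Ss; apply/asboolP => I; apply. Qed.

Lemma gen_sub_ker (W : zmodType) (f : {additive V -> W}) :
  (forall s, S s -> f s = 0) -> forall x, x \in gen_sub -> f x = 0.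
Proof.
move=> fS x /asboolP hx.
pose K : {pred V} := fun x => f x == 0.
have Kc : zmod_closed K.
  split; first by rewrite unfold_in raddf0.
  by move=> u v; rewrite !unfold_in raddfB => /eqP-> /eqP->; rewrite subr0.
pose KI := GRing.isZmodClosed.Build V K Kc.
pose KK : zmodClosed V := HB.pack K KI.
by apply/eqP; apply: (hx KK) => s /fS fs; rewrite unfold_in /= /K fs.
Qed.
End Generated.

Definition biadditive (A B N : zmodType) (beta : A -> B -> N) : Prop :=
  (forall a a' b, beta (a + a') b = beta a b + beta a' b) /\
  (forall a b b', beta a (b + b') = beta a b + beta a b').

(* A (x) B over Z: the free abelian group on A * B modulo biadditivity. *)
Section Tensor.
Variables (A B : zmodType).

Definition tensor_rel : set {freeg (A * B)%type / int} := fun x =>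
  (exists a a' b, x = << (a + a', b) >> - << (a, b) >> - << (a', b) >>) \/
  (exists a b b', x = << (a, b + b') >> - << (a, b) >> - << (a, b') >>).

Definition tensor : zmodType := {quot (gen_sub tensor_rel)}.

Definition tens (a : A) (b : B) : tensor :=
  \pi_{quot (gen_sub tensor_rel)} << (a, b) >>.

Lemma tens_biadditive : biadditive tens.
Proof.
split=> [a a' b|a b b']; apply/eqP; rewrite -subr_eq0 opprD addrA /tens -!raddfB;
  rewrite -(raddf0 \pi_{quot (gen_sub tensor_rel)}) -Quotient.idealrBE subr0;
  apply: mem_gen; [left; by exists a, a', b | right; by exists a, b, b'].
Qed.

Section Lift.
Variables (N : zmodType) (beta : A -> B -> N) (betaB : biadditive beta).

Definition free_lift (x : {freeg (A * B)%type / int}) : N :=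
  fglift (fun p : A * B => beta p.1 p.2 : zmodule N) x.

Lemma free_lift_is_zmod_morphism : zmod_morphism free_lift.
Proof.
move=> x y.
exact: (@lift_is_additive int (A * B)%type (zmodule N)
          (fun p => beta p.1 p.2) x y).
Qed.

HB.instance Definition _ :=
  GRing.isZmodMorphism.Build _ _ free_lift free_lift_is_zmod_morphism.

Lemma free_liftU a b : free_lift << (a, b) >> = beta a b.
Proof. by rewrite /free_lift liftU scale1r. Qed.

Lemma free_lift_rel x : x \in gen_sub tensor_rel -> free_lift x = 0.
Proof.
case: betaB => bl br; apply: gen_sub_ker => s.
by case=> -[a [b [c ->]]]; rewrite !raddfB /= !free_liftU (bl, br) addrAC addrK subrr.
Qed.

Definition tensor_lift : {additive tensor -> N} := quot_lift free_lift_rel.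

Lemma tensor_liftE a b : tensor_lift (tens a b) = beta a b.
Proof. exact: etrans (quot_liftE _ _) (free_liftU _ _). Qed.
End Lift.

Lemma tensor_ext (N : zmodType) (f g : {additive tensor -> N}) :
  (forall a b, f (tens a b) = g (tens a b)) -> f = g.
Proof.
move=> fg; apply: hom_ext; elim/quotW => x.
rewrite -[x]freeg_sumE !raddf_sum; apply: eq_bigr => -[a b] _.
have -> : << coeff (a, b) x *g (a, b) >>
        = << (a, b) >> *~ coeff (a, b) x :> {freeg (A * B)%type / int}.
  by rewrite freegU_mulz intz.
by rewrite !raddfMz -/(tens a b) fg.
Qed.
End Tensor.

(* S^2(A) = (A (x) A) / < a (x) b - b (x) a >. *)
Section SymSquare.
Variable A : zmodType.

Definition sym_rel : set (tensor A A) := fun x =>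
  exists a b, x = tens a b - tens b a.

Definition S2 : zmodType := {quot (gen_sub sym_rel)}.

Definition smul (a b : A) : S2 := \pi_{quot (gen_sub sym_rel)} (tens a b).

Lemma smulC a b : smul a b = smul b a.
Proof.
apply/eqP; rewrite -subr_eq0 /smul -raddfB.
rewrite -(raddf0 \pi_{quot (gen_sub sym_rel)}) -Quotient.idealrBE subr0.
by apply: mem_gen; exists a, b.
Qed.

Lemma smul_biadditive : biadditive smul.
Proof.
have [tl tr] := @tens_biadditive A A.
by split=> a b c; rewrite /smul (tl, tr) raddfD.
Qed.

Section Lift.
Variables (N : zmodType) (beta : A -> A -> N).
Hypotheses (betaB : biadditive beta) (betaC : forall a b, beta a b = beta b a).

Lemma tensor_lift_sym x : x \in gen_sub sym_rel -> tensor_lift betaB x = 0.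
Proof.
apply: gen_sub_ker => _ [a [b ->]].
by rewrite raddfB !tensor_liftE betaC subrr.
Qed.

Definition S2_lift : {additive S2 -> N} := quot_lift tensor_lift_sym.

Lemma S2_liftE a b : S2_lift (smul a b) = beta a b.
Proof. exact: etrans (quot_liftE _ _) (tensor_liftE _ _ _). Qed.
End Lift.

Lemma S2_ext (N : zmodType) (f g : {additive S2 -> N}) :
  (forall a b, f (smul a b) = g (smul a b)) -> f = g.
Proof.
move=> fg; apply: hom_ext; elim/quotW => x.
pose p : {additive tensor A A -> S2} := \pi_{quot (gen_sub sym_rel)}.
suff fpgp : (f \o p : {additive tensor A A -> N}) = (g \o p).
  exact: (congr1 (fun h : {additive tensor A A -> N} => h x) fpgp).
by apply: tensor_ext => a b /=; exact: fg.
Qed.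
End SymSquare.


Section Polar.
Variables (A N : zmodType).

Definition polar (q : A -> N) (a1 a2 : A) : N := q (a1 + a2) - q a1 - q a2.

Lemma polarC (q : A -> N) a1 a2 : polar q a1 a2 = polar q a2 a1.
Proof. by rewrite /polar addrC addrAC [a1 + a2]addrC [- _ + _]addrC. Qed.

Lemma polarB (p q : A -> N) a1 a2 : polar (p - q) a1 a2 = polar p a1 a2 - polar q a1 a2.
Proof. by apply/subr0_eq; rewrite /polar !fctE; zmod_cancel. Qed.
End Polar.

Section QuadraticForms.
Variables (A N : zmodType).

Definition is_quadratic (g : A -> N) : Prop :=
  (forall a, g a = g (- a)) /\
  (forall a b c, g (a + b + c) - g (b + c) - g (a + c) - g (a + b)
                 + g a + g b + g c = 0).

Definition quad_pred : {pred A -> N} := fun g => `[< is_quadratic g >].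

Lemma quad_pred_closed : zmod_closed quad_pred.
Proof.
split; first by apply/asboolP; split=> *; rewrite ?subr0 ?addr0.
move=> f g /asboolP [fN fQ] /asboolP [gN gQ]; apply/asboolP; split.
  by move=> a; rewrite !fctE fN gN.
move=> a b c; apply: (eq0_via (fQ a b c) (gQ a b c)).
by rewrite !fctE; zmod_cancel.
Qed.

HB.instance Definition _ :=
  GRing.isZmodClosed.Build (A -> N) quad_pred quad_pred_closed.

Record Quad := MkQuad { quad_fun :> A -> N; quadP : quad_fun \in quad_pred }.

HB.instance Definition _ := [isSub for quad_fun].
HB.instance Definition _ := [Choice of Quad by <:].
HB.instance Definition _ := [SubChoice_isSubZmodule of Quad by <:].

Lemma quadB (p q : Quad) : quad_fun (p - q) = quad_fun p - quad_fun q.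
Proof. exact: (raddfB (val : Quad -> (A -> N))). Qed.

Lemma polar_biadditive (q : Quad) : biadditive (polar q).
Proof.
have [_ qQ] := asboolP _ (quadP q).
have polarDl a a' b : polar q (a + a') b = polar q a b + polar q a' b.
  apply/subr0_eq; apply: (eq0_via (qQ a a' b) (erefl 0)).
  by rewrite subr0 /polar; zmod_cancel.
by split=> // a b b'; rewrite polarC polarDl !(polarC _ a).
Qed.

Definition b_quad_hom (q : Quad) : {additive S2 A -> N} :=
  S2_lift (polar_biadditive q) (polarC q).

Lemma b_quad_homE q a1 a2 : b_quad_hom q (smul a1 a2) = polar q a1 a2.
Proof. exact: S2_liftE. Qed.

Lemma b_quad_hom_is_zmod_morphism : zmod_morphism b_quad_hom.
Proof.
move=> p q; apply: S2_ext => a1 a2.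
by rewrite homBE !b_quad_homE quadB polarB.
Qed.

HB.instance Definition _ :=
  GRing.isZmodMorphism.Build _ _ b_quad_hom b_quad_hom_is_zmod_morphism.

Definition b_quad : {additive Quad -> {additive S2 A -> N}} := b_quad_hom.

Lemma b_quadE q a1 a2 : b_quad q (smul a1 a2) = polar q a1 a2.
Proof. exact: b_quad_homE. Qed.
End QuadraticForms.

Arguments b_quad {A N}.

Section AbelianCohomology.
Variables (A N : zmodType).

Definition ab_cochain : zmodType := ((A -> A -> A -> N) * (A -> A -> N))%type.

Definition is_ab_cocycle (p : ab_cochain) : Prop :=
  let: (w, c) := p in
  [/\ forall x y z t, w y z t - w (x + y) z t + w x (y + z) t
                      - w x y (z + t) + w x y z = 0,
      forall x y z, c x z - c x (y + z) + c x y
                    + w x y z - w y x z + w y z x = 0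
    & forall x y z, c y z - c (x + y) z + c x z
                    - w x y z + w x z y - w z x y = 0].

Definition Z3ab_pred : {pred ab_cochain} := fun p => `[< is_ab_cocycle p >].

Lemma Z3ab_pred_closed : zmod_closed Z3ab_pred.
Proof.
split.
  have h5 : 0 - 0 + 0 - 0 + 0 = 0 :> N by rewrite !(subr0, addr0).
  have h6 : 0 - 0 + 0 + 0 - 0 + 0 = 0 :> N by rewrite !(subr0, addr0).
  have h6' : 0 - 0 + 0 - 0 + 0 - 0 = 0 :> N by rewrite !(subr0, addr0).
  by apply/asboolP; split=> *; [exact: h5|exact: h6|exact: h6'].
move=> [w c] [w' c'] /asboolP [h1 h2 h3] /asboolP [k1 k2 k3].
have -> : (w, c) - (w', c') = (w - w', c - c') :> ab_cochain by [].
apply/asboolP; split=> [x y z t|x y z|x y z].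
- by apply: (eq0_via (h1 x y z t) (k1 x y z t)); rewrite !fctE; zmod_cancel.
- by apply: (eq0_via (h2 x y z) (k2 x y z)); rewrite !fctE; zmod_cancel.
- by apply: (eq0_via (h3 x y z) (k3 x y z)); rewrite !fctE; zmod_cancel.
Qed.

HB.instance Definition _ :=
  GRing.isZmodClosed.Build ab_cochain Z3ab_pred Z3ab_pred_closed.

Record Z3ab := MkZ3ab { Z3ab_val : ab_cochain;
                        Z3abP : Z3ab_val \in Z3ab_pred }.

HB.instance Definition _ := [isSub for Z3ab_val].
HB.instance Definition _ := [Choice of Z3ab by <:].
HB.instance Definition _ := [SubChoice_isSubZmodule of Z3ab by <:].

Lemma Z3ab_val0 : Z3ab_val 0 = 0.
Proof. exact: (raddf0 (val : Z3ab -> ab_cochain)). Qed.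

Lemma Z3ab_valB z z' : Z3ab_val (z - z') = Z3ab_val z - Z3ab_val z'.
Proof. exact: (raddfB (val : Z3ab -> ab_cochain)). Qed.

Definition ab_coboundary (f : A -> A -> N) : ab_cochain :=
  (fun x y z => f y z - f (x + y) z + f x (y + z) - f x y,
   fun x y => f x y - f y x).

Lemma ab_coboundary_is_cocycle f : ab_coboundary f \in Z3ab_pred.
Proof.
apply/asboolP; split=> [x y z t|x y z|x y z] /=.
- by rewrite !addrA; zmod_cancel.
- by rewrite [z + x]addrC [y + x]addrC; zmod_cancel.
- by rewrite [z + x]addrC [z + y]addrC; zmod_cancel.
Qed.

Definition B3ab : {pred Z3ab} :=
  fun z => `[< exists f, Z3ab_val z = ab_coboundary f >].

Lemma B3ab_closed : zmod_closed B3ab.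
Proof.
split.
  apply/asboolP; exists 0; rewrite Z3ab_val0.
  have h4 : 0 = 0 - 0 + 0 - 0 :> N by rewrite !(subr0, addr0).
  have h2 : 0 = 0 - 0 :> N by rewrite subr0.
  by congr pair; do ![apply/funext=> ?]; [exact: h4 | exact: h2].
move=> z z' /asboolP [f zf] /asboolP [f' zf']; apply/asboolP.
exists (f - f'); rewrite Z3ab_valB zf zf'.
by congr pair; do ![apply/funext=> ?]; apply/subr0_eq; rewrite /= !fctE; zmod_cancel.
Qed.

HB.instance Definition _ := GRing.isZmodClosed.Build Z3ab B3ab B3ab_closed.

Definition H3ab : zmodType := {quot B3ab}.

Definition cls : {additive Z3ab -> H3ab} := \pi_{quot B3ab}.

Definition diag (z : Z3ab) (a : A) : N := (Z3ab_val z).2 a a.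

Lemma polar_diag (z : Z3ab) x y :
  polar (diag z) x y = (Z3ab_val z).2 x y + (Z3ab_val z).2 y x.
Proof.
rewrite /polar /diag; case: z => [[w c] /= /asboolP [h1 h2 h3]].
have h : c y (x + y) - c (x + y) (x + y) + c x (x + y) - w x y (x + y)
         + w x (x + y) y - w (x + y) x y
         + (c x y - c x (x + y) + c x x + w x x y - w x x y + w x y x)
         + (c y y - c y (x + y) + c y x + w y x y - w x y y + w x y y) = 0.
  by rewrite h3 h2 h2 !addr0.
apply/subr0_eq; apply: (eq0_via (h1 x y x y) h).
by rewrite [y + x]addrC; zmod_cancel.
Qed.

Lemma polar_diag_biadditive (z : Z3ab) : biadditive (polar (diag z)).
Proof.
have Dl a a' b :
    polar (diag z) (a + a') b = polar (diag z) a b + polar (diag z) a' b.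
  rewrite !polar_diag; case: z => [[w c] /= /asboolP [h1 h2 h3]].
  apply/subr0_eq/eqP; rewrite -oppr_eq0; apply/eqP.
  have h : - (c b a' - c b (a + a') + c b a + w b a a' - w a b a' + w a a' b) = 0.
    by rewrite h2 oppr0.
  by apply: (eq0_via (h3 a a' b) h); zmod_cancel.
by split=> // a b b'; rewrite polarC Dl !(polarC _ a).
Qed.

Lemma diag_quad (z : Z3ab) : diag z \in @quad_pred A N.
Proof.
have [Dl Dr] := polar_diag_biadditive z.
have q0 : diag z 0 = 0.
  have : polar (diag z) 0 0 = 0.
    by apply: (addrI (polar (diag z) 0 0)); rewrite -Dl !addr0.
  by rewrite /polar addr0 subrr sub0r => /eqP; rewrite oppr_eq0 => /eqP.
apply/asboolP; split=> [a|a b c].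
  have h := Dr a a (- a); rewrite (polar_diag z a a) /polar subrr addr0 q0 in h.
  rewrite !(subrr, subr0) sub0r in h.
  by apply/subr0_eq; apply: (eq0_via (esym h) (erefl 0)); rewrite /diag subr0; zmod_cancel.
have /eqP := Dl a b c; rewrite -subr_eq0 => /eqP h.
apply: (eq0_via h (erefl 0)); rewrite subr0 /polar; zmod_cancel.
by [].
Qed.

Definition trace_cocycle (z : Z3ab) : Quad A N := MkQuad (diag_quad z).

Lemma trace_cocycle_is_zmod_morphism : zmod_morphism trace_cocycle.
Proof. by move=> z z'; apply: val_inj. Qed.

HB.instance Definition _ :=
  GRing.isZmodMorphism.Build _ _ trace_cocycle trace_cocycle_is_zmod_morphism.

Lemma trace_coboundary z : z \in B3ab -> trace_cocycle z = 0.
Proof.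
move=> /asboolP [f zf]; apply: val_inj; apply/funext => a.
by rewrite /= /diag zf /= subrr.
Qed.

Definition Tr : {additive H3ab -> Quad A N} := quot_lift trace_coboundary.

Lemma Tr_cls z a : Tr (cls z) a = (Z3ab_val z).2 a a.
Proof. by rewrite /Tr quot_liftE. Qed.

Definition b_H3ab : {additive H3ab -> {additive S2 A -> N}} :=
  b_quad \o Tr.

(* Equivalently c(x, y) + c(y, x) = 0, by polar_diag. *)
Definition symmetric_cocycle (z : Z3ab) : Prop :=
  forall x y, polar (diag z) x y = 0.

Definition H3s_pred : {pred H3ab} := fun h =>
  `[< exists z, symmetric_cocycle z /\ cls z = h >].

Lemma H3s_pred_closed : zmod_closed H3s_pred.
Proof.
split.
  by apply/asboolP; exists 0; rewrite raddf0; split=> // x y;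
     rewrite polar_diag; exact: addr0.
move=> h h' /asboolP [z [zs <-]] /asboolP [z' [zs' <-]]; apply/asboolP.
exists (z - z'); rewrite raddfB; split=> // x y.
by rewrite -[RHS](subrr 0) -{1}(zs x y) -(zs' x y) -polarB.
Qed.

HB.instance Definition _ :=
  GRing.isZmodClosed.Build H3ab H3s_pred H3s_pred_closed.

Record H3s := MkH3s { H3s_val : H3ab; H3sP : H3s_val \in H3s_pred }.

HB.instance Definition _ := [isSub for H3s_val].
HB.instance Definition _ := [Choice of H3s by <:].
HB.instance Definition _ := [SubChoice_isSubZmodule of H3s by <:].

Lemma H3s_valB h h' : H3s_val (h - h') = H3s_val h - H3s_val h'.
Proof. exact: (raddfB (val : H3s -> H3ab)). Qed.

Definition H3s_incl : {additive H3s -> H3ab} := \val.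

Lemma polar_Tr_H3s (h : H3s) a1 a2 : polar (Tr (H3s_val h)) a1 a2 = 0.
Proof.
have /asboolP [z [zs <-]] := H3sP h.
by rewrite -(zs a1 a2) /polar !Tr_cls.
Qed.
End AbelianCohomology.

Arguments cls {A N}.
Arguments Tr {A N}.
Arguments b_H3ab {A N}.
Arguments H3s_incl {A N}.

Section RmodZ.
Variable R : realType.

Definition int_sub : {pred R} := fun r => r \is a Num.int.

Lemma int_sub_closed : zmod_closed int_sub.
Proof.
have h0 : (0 : R) \is a Num.int by apply: rpred0.
have hB (x y : R) : x \is a Num.int -> y \is a Num.int -> x - y \is a Num.int.
  by move=> xZ yZ; apply: rpredB.
by split=> [|x y]; [exact: h0 | exact: hB].
Qed.

HB.instance Definition _ := GRing.isZmodClosed.Build R int_sub int_sub_closed.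

Definition RmodZ : zmodType := {quot int_sub}.

Definition toRmodZ : {additive R -> RmodZ} := \pi_{quot int_sub}.

Lemma toRmodZ_eq0 (r : R) : (toRmodZ r = 0) <-> (r \is a Num.int).
Proof.
rewrite -(raddf0 toRmodZ); split=> [/eqP | rZ].
  by rewrite -Quotient.idealrBE subr0.
by apply/eqP; rewrite -Quotient.idealrBE subr0.
Qed.

Lemma toRmodZ_surj (x : RmodZ) : exists r, toRmodZ r = x.
Proof. by exists (repr x); exact: reprK. Qed.

Definition half_pred : {pred RmodZ} := fun x =>
  `[< exists m : int, x = toRmodZ (m%:~R / 2) >].

Lemma half_predP x : reflect (x + x = 0) (x \in half_pred).
Proof.
apply: (iffP idP) => [/asboolP [m ->] | ].
  rewrite -raddfD -splitr; apply/toRmodZ_eq0; exact: intr_int.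
have [r <-] := toRmodZ_surj x; rewrite -raddfD => /toRmodZ_eq0 /intrP [m rm].
by apply/asboolP; exists m; rewrite -rm mulrDl -splitr.
Qed.

Lemma half_pred_closed : zmod_closed half_pred.
Proof.
split; first by apply/half_predP; rewrite addr0.
move=> x y /half_predP hx /half_predP hy; apply/half_predP.
by rewrite addrACA hx add0r -opprD hy oppr0.
Qed.

HB.instance Definition _ :=
  GRing.isZmodClosed.Build RmodZ half_pred half_pred_closed.

Record HalfZ := MkHalfZ { HalfZ_val : RmodZ; HalfZP : HalfZ_val \in half_pred }.

HB.instance Definition _ := [isSub for HalfZ_val].
HB.instance Definition _ := [Choice of HalfZ by <:].
HB.instance Definition _ := [SubChoice_isSubZmodule of HalfZ by <:].

Lemma HalfZ_valD x y : HalfZ_val (x + y) = HalfZ_val x + HalfZ_val y.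
Proof. exact: (raddfD (val : HalfZ -> RmodZ)). Qed.

Lemma HalfZ_valN x : HalfZ_val (- x) = - HalfZ_val x.
Proof. exact: (raddfN (val : HalfZ -> RmodZ)). Qed.

Lemma HalfZ_valB x y : HalfZ_val (x - y) = HalfZ_val x - HalfZ_val y.
Proof. by rewrite HalfZ_valD HalfZ_valN. Qed.

Lemma HalfZ_double x : HalfZ_val x + HalfZ_val x = 0.
Proof. exact/half_predP/HalfZP. Qed.

Variable A : zmodType.

Lemma hom_half_quad (f : {additive A -> HalfZ}) :
  (fun a => HalfZ_val (f a)) \in @quad_pred A RmodZ.
Proof.
apply/asboolP; split=> [a|a b c].
  by rewrite (raddfN f) HalfZ_valN; apply/subr0_eq; rewrite opprK HalfZ_double.
by rewrite !(raddfD f) !HalfZ_valD; zmod_cancel.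
Qed.

Definition Hom_quad (f : {additive A -> HalfZ}) : Quad A RmodZ :=
  MkQuad (hom_half_quad f).

Lemma Hom_quad_is_zmod_morphism : zmod_morphism Hom_quad.
Proof.
by move=> f g; apply: val_inj; apply/funext => a; exact: HalfZ_valB.
Qed.

HB.instance Definition _ :=
  GRing.isZmodMorphism.Build _ _ Hom_quad Hom_quad_is_zmod_morphism.

Lemma Tr_H3s_half (h : H3s A RmodZ) a : Tr (H3s_val h) a \in half_pred.
Proof.
apply/half_predP; have /asboolP [z [zs <-]] := H3sP h.
by rewrite !Tr_cls -polar_diag zs.
Qed.

Definition Tr_s_fun (h : H3s A RmodZ) (a : A) : HalfZ := MkHalfZ (Tr_H3s_half h a).

Lemma Tr_s_fun_is_zmod_morphism h : zmod_morphism (Tr_s_fun h).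
Proof.
have D : {morph Tr_s_fun h : a b / a + b}.
  move=> a b; apply: val_inj; rewrite raddfD /=; apply/subr0_eq.
  by rewrite opprD addrA; exact: polar_Tr_H3s.
have Z : Tr_s_fun h 0 = 0 by apply: (addrI (Tr_s_fun h 0)); rewrite -D !addr0.
have Nn b : Tr_s_fun h (- b) = - Tr_s_fun h b.
  by apply: (addrI (Tr_s_fun h b)); rewrite -D !subrr.
by move=> a b; rewrite D Nn.
Qed.

Definition Tr_s_hom (h : H3s A RmodZ) : {additive A -> HalfZ} :=
  HB.pack (Tr_s_fun h)
    (GRing.isZmodMorphism.Build _ _ (Tr_s_fun h) (Tr_s_fun_is_zmod_morphism h)).

Lemma Tr_s_hom_is_zmod_morphism : zmod_morphism Tr_s_hom.
Proof.
move=> h h'; apply: hom_ext => a; apply: val_inj.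
have E : Tr (H3s_val (h - h')) = Tr (H3s_val h) - Tr (H3s_val h').
  by rewrite H3s_valB raddfB.
exact: (congr1 (fun q : Quad A RmodZ => q a) E).
Qed.

HB.instance Definition _ :=
  GRing.isZmodMorphism.Build _ _ Tr_s_hom Tr_s_hom_is_zmod_morphism.

Definition Tr_s : {additive H3s A RmodZ -> {additive A -> HalfZ}} := Tr_s_hom.

Definition Hom_incl : {additive {additive A -> HalfZ} -> Quad A RmodZ} :=
  Hom_quad.
End RmodZ.

Arguments Tr_s {R A}.
Arguments Hom_incl {R A}.

Definition short_exact (X Y Z : zmodType)
    (f : {additive X -> Y}) (g : {additive Y -> Z}) : Prop :=
  [/\ injective f,
      forall y, g y = 0 <-> exists x, f x = y
    & forall z, exists y, g y = z].

(* Main.v *)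
(* Write N = R/Z, which is divisible, so homomorphisms into N extend from
   subgroups; in particular symmetric 2-cocycles with values in N split, and a
   system of Z-linear equations over N is solvable as soon as its finite
   subsystems are.

   Tr is injective.  The claim "a cocycle (w, c) with c(a, a) = 0 is a coboundary"
   passes from B to B + Z by making multiplication by the new generator t strict
   on both sides, after which w(x, y, z) only involves gamma(b) = c(b, t) and is an
   explicit coboundary.  From F it passes to the image of any F -> A, since the
   trivialization over F can be corrected by splitting its restriction to the
   kernel.  Hence the equations defining f have a solution near any finite subset
   of A, and compactness gives a global one.

   Tr is surjective.  On the free group F on the set A, q lifts to c(x, x) with c
   bilinear.  On K = ker (F -> A) the form c is alternating, so (0, c) restricted
   to K is the coboundary of some g by injectivity of Tr for K; g and c turn the
   failure of additivity of the section A -> F into an explicit cocycle on A.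

   b is surjective.  A symmetric bilinear beta is a symmetric 2-cocycle, hence
   the polarization of some q0; the defect of evenness of q0 is a homomorphism
   killing the 2-torsion, so it is twice a homomorphism, which corrects q0. *)

Require Import Defs.
From HB Require Import structures.
From mathcomp Require Import all_boot all_order all_algebra.
From mathcomp Require Import ring_quotient freeg.
From mathcomp Require Import boolp classical_sets functions reals.

Set Implicit Arguments.
Unset Strict Implicit.
Unset Printing Implicit Defensive.

Import GRing.Theory Num.Theory.

Local Open Scope ring_scope.

(** * Divisible groups are injective *)

Lemma eq_lin (V : zmodType) (s t u v : V) :
  s = t -> u - v - (s - t) = 0 -> u = v.
Proof. by move=> ->; rewrite subrr subr0 => /subr0_eq. Qed.

Lemma set_eq (T : Type) (G : set T) (x y : T) : G x -> x = y -> G y.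
Proof. by move=> Gx <-. Qed.

Ltac zmod :=
  try apply/subr0_eq;
  rewrite ?(mulNrz, mulrNz, oppr0, addr0, add0r);
  first [reflexivity | zmod_cancel; reflexivity].

Definition divisible (N : zmodType) : Prop :=
  forall (n : nat) (x : N), (0 < n)%N -> exists y, y *+ n = x.

Section Injectivity.
Variables (E N : zmodType).
Hypothesis divN : divisible N.

Definition sub_closed (V : zmodType) (G : set V) : Prop :=
  forall x y, G x -> G y -> G (x - y).

(** For a [sub_closed] relation this makes it the graph of a partial map, since two values over one
    point differ by a value over 0. *)
Definition functional (G : set (E * N)) : Prop := forall d, G (0, d) -> d = 0.

(** If no positive multiple of [a] lies in the domain, any value will do. Otherwise take the least
    such multiplier [n] and divide the value at [a *+ n] by [n]; Euclidean division shows that [n]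
    divides every [m] concerned. *)
Lemma extension_value (G : set (E * N)) (a : E) :
  G (0, 0) -> sub_closed G -> functional G ->
  exists y, forall (m : int) d, G (a *~ m, d) -> d = y *~ m.
Proof.
move=> G0 GB Gf.
have GN x : G x -> G (- x) by move=> Gx; rewrite -sub0r; exact: GB.
have GD x y : G x -> G y -> G (x + y).
  by move=> Gx Gy; rewrite -[y]opprK; apply: GB => //; exact: GN.
have GM x (n : nat) : G x -> G (x *+ n).
  by move=> Gx; elim: n => [|n IH]; rewrite ?mulr0n // mulrS; exact: GD.
have GZ x (k : int) : G x -> G (x *~ k).
  by case: k => n Gx; [exact: GM | rewrite NegzE mulrNz; apply/GN/GM].
have [[n0 [n0_gt0 [d0 Gd0]]]|no] :=
    pselect (exists n : nat, (0 < n)%N /\ exists d, G (a *+ n, d)); last first.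
  exists 0 => m d Gmd; rewrite mul0rz.
  case: m Gmd => [[|n]|n] Gmd; first by apply: Gf.
    by case: no; exists n.+1; split=> //; exists d.
  case: no; exists n.+1; split=> //; exists (- d).
  apply: (set_eq (GN _ Gmd)); apply: injective_projections => //=.
  by rewrite NegzE mulrNz opprK.
pose P (n : nat) := (0 < n)%N && `[< exists d, G (a *+ n, d) >].
have exP : exists n, P n.
  by exists n0; rewrite /P n0_gt0; apply/asboolP; exists d0.
have [n /andP[n_gt0 /asboolP[dn Gdn]] nmin] := ex_minnP exP.
have [y yn] := divN dn n_gt0.
exists y => m d Gmd.
have m_eq := divz_eq m n; set k := (m %/ n)%Z in m_eq; set r := (m %% n)%Z in m_eq.
have nz : n%:Z != 0 by rewrite eqz_nat -lt0n.
have [r' rE] : exists r' : nat, r = r'.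
  by move: (modz_ge0 m nz); rewrite -/r; case: (r) => // r' _; exists r'.
have r'n : (r' < n)%N by have := ltz_mod m nz; rewrite -/r rE.
have Gk : G (a *~ (k * n), dn *~ k).
  apply: (set_eq (GZ _ k Gdn)); apply: injective_projections => /=.
    by rewrite (raddfMz fst) /= mulrC mulrzA.
  by rewrite (raddfMz snd).
have Gr : G (a *+ r', d - dn *~ k).
  apply: (set_eq (GB _ _ Gmd Gk)); apply: injective_projections => //=.
  by rewrite -mulrzBr m_eq addrAC subrr add0r rE.
have r'0 : r' = 0%N.
  case: (posnP r') => // r'_gt0.
  have /nmin : P r' by rewrite /P r'_gt0; apply/asboolP; exists (d - dn *~ k).
  by rewrite leqNgt r'n.
rewrite r'0 mulr0n in Gr.
by rewrite m_eq rE r'0 addr0 mulrC mulrzA -[y *~ n]/(y *+ n) yn; apply/subr0_eq/Gf.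
Qed.

Lemma injective_extension (G0 : set (E * N)) :
  G0 (0, 0) -> sub_closed G0 -> functional G0 ->
  exists phi : {additive E -> N}, forall x d, G0 (x, d) -> phi x = d.
Proof.
move=> G00 G0B G0f.
pose good (G : set (E * N)) := sub_closed G /\ functional G.
(* Adjoining [G0] inside [P], rather than asking [G] to contain it, lets the empty chain satisfy
   Zorn's condition. *)
pose P (G : set (E * N)) := good (G `|` G0)%classic.
have [F FP Ftot|G [[GB Gf] Gmax]] := @Zorn_bigcup _ P.
  have [[X0 FX0]|F0] := pselect (exists X, F X); last first.
    suff -> : (\bigcup_(X in F) X)%classic = set0 by rewrite /P set0U.
    by apply/seteqP; split=> // x [X FX _]; case: F0; exists X.
  have mem x : ((\bigcup_(X in F) X) `|` G0)%classic x ->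
      exists2 X, F X & (X `|` G0)%classic x.
    by case=> [[X FX Xx]|G0x]; [exists X => //; left | exists X0 => //; right].
  have sub X : F X -> (X `|` G0 `<=` (\bigcup_(X in F) X) `|` G0)%classic.
    by move=> FX x [Xx|G0x]; [left; exists X | right].
  split=> [x y /mem[X FX Xx] /mem[Y FY Yy]|d /mem[X FX Xd]].
    have [XY|YX] := Ftot _ _ FX FY.
      apply: (sub Y) => //; apply: (FP _ FY).1 => //.
      by case: Xx => [/XY|]; [left | right].
    apply: (sub X) => //; apply: (FP _ FX).1 => //.
    by case: Yy => [/YX|]; [left | right].
  exact: (FP _ FX).2.
set H := (G `|` G0)%classic in GB Gf.
have H0 : H (0, 0) by right.
have HN x : H x -> H (- x) by move=> Hx; rewrite -sub0r; exact: GB.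
have total a : exists d, H (a, d).
  have [y yP] := extension_value a H0 GB Gf.
  (* The subgroup generated by [H] and [(a, y)]; the choice of [y] keeps it functional. *)
  pose H' : set (E * N) := fun p =>
    exists m : int, H (p.1 - a *~ m, p.2 - y *~ m).
  have HH' : (H `<=` H')%classic.
    by move=> [x d] Hx; exists 0; rewrite !mulr0z !subr0.
  have [H'H|nH'H] := pselect (H' `<=` H)%classic.
    exists y; apply: H'H; exists 1; rewrite !mulr1z !subrr; exact: H0.
  case: (Gmax H').
    split; last by move=> GH'; apply: nH'H => p /GH' ?; left.
    by move=> x Gx; apply: HH'; left.
  have -> : P H' = good H'.
    rewrite /P; congr good; apply/seteqP; split=> x; last by left.
    by case=> // G0x; apply: HH'; right.
  split=> [[x d] [x' d'] [m Hm] [m' Hm']|d [m /= Hm]].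
    exists (m - m'); apply: (set_eq (GB _ _ Hm Hm')).
    by apply: injective_projections => /=; rewrite mulrzBr; zmod.
  have /yP : H (a *~ m, y *~ m - d).
    apply: (set_eq (HN _ Hm)).
    by apply: injective_projections => /=; rewrite ?sub0r ?opprK ?opprB.
  by move/eqP; rewrite -subr_eq0 addrAC subrr sub0r oppr_eq0 => /eqP.
pose phi a := projT1 (cid (total a)).
have phiH a : H (a, phi a) by rewrite /phi; case: cid.
have Hphi a d : H (a, d) -> phi a = d.
  move=> Had; apply/subr0_eq/Gf.
  apply: (set_eq (GB _ _ (phiH a) Had)).
  by apply: injective_projections => //=; rewrite subrr.
have phiB : zmod_morphism phi.
  by move=> a b; apply: Hphi; exact: (GB _ _ (phiH a) (phiH b)).
exists (HB.pack_for {additive E -> N} phi (GRing.isZmodMorphism.Build _ _ phi phiB)).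
by move=> x d G0x; apply: Hphi; right.
Qed.
End Injectivity.

(** * Splitting and compactness *)

Definition is_2cocycle (K N : zmodType) (f : K -> K -> N) : Prop :=
  forall x y z, f y z - f (x + y) z + f x (y + z) - f x y = 0.

Section CentralExtension.
Variables (K N : zmodType) (f : K -> K -> N).
Hypotheses (fZ : is_2cocycle f) (fC : forall x y, f x y = f y x).

Let f0r x : f x 0 = f 0 0.
Proof. by apply/esym/subr0_eq; rewrite -(fZ x 0 0) !addr0; zmod. Qed.

Let f0l x : f 0 x = f 0 0. Proof. by rewrite fC f0r. Qed.

(** The abelian extension of [K] by [N] with factor set [f]. As [f] need not be normalized, its zero
    is [(0, - f 0 0)], and [d] in [N] embeds as [(0, d - f 0 0)]. *)
Definition central_ext : Type := (K * N)%type.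
HB.instance Definition _ := Choice.on central_ext.

Definition ext_add (p q : central_ext) : central_ext :=
  (p.1 + q.1, p.2 + q.2 + f p.1 q.1).
Definition ext_zero : central_ext := (0, - f 0 0).
Definition ext_opp (p : central_ext) : central_ext :=
  (- p.1, - p.2 - f p.1 (- p.1) - f 0 0).

Lemma ext_addA : associative ext_add.
Proof.
move=> [x a] [y b] [z c]; apply: injective_projections; rewrite /= ?addrA //.
by apply: (eq_lin (fZ x y z)); zmod.
Qed.

Lemma ext_addC : commutative ext_add.
Proof.
move=> [x a] [y b]; apply: injective_projections => /=; first exact: addrC.
by rewrite fC [a + b]addrC.
Qed.

Lemma ext_add0 : left_id ext_zero ext_add.
Proof.
move=> [x a]; apply: injective_projections => /=; first exact: add0r.
by rewrite f0l; zmod.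
Qed.

Lemma ext_addN : left_inverse ext_zero ext_opp ext_add.
Proof.
move=> [x a]; apply: injective_projections => /=; first exact: addNr.
by rewrite [f (- x) x]fC; zmod.
Qed.

HB.instance Definition _ :=
  GRing.isZmodule.Build central_ext ext_addA ext_addC ext_add0 ext_addN.

(** Divisibility retracts the extension onto [N]. On the section [(x, 0)], whose failure to be
    additive is [f], the retraction gives [g]. *)
Lemma sym_cocycle_split : divisible N ->
  exists g : K -> N, forall x y, f x y = g x + g y - g (x + y).
Proof.
move=> divN.
pose G (p : central_ext * N) := p.1 = (0, p.2 - f 0 0).
have [|||phi phiG] := @injective_extension central_ext N divN G.
- by rewrite /G /= sub0r.
- move=> [x d] [y e]; rewrite /G /= => -> ->.
  apply: injective_projections => /=; first by rewrite oppr0 addr0.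
  by rewrite oppr0; zmod.
- by move=> d [/esym/eqP]; rewrite subr_eq addNr => /eqP.
exists (fun x => phi (x, 0)) => x y.
have <- : phi (0, f x y - f 0 0) = f x y by exact: phiG.
apply/esym/eqP; rewrite subr_eq -!raddfD; apply/eqP; congr (phi _).
apply: injective_projections => /=; first by rewrite add0r.
by rewrite f0l; zmod.
Qed.
End CentralExtension.

Section FreeLift.
Variables (X : choiceType) (N : zmodType) (h : X -> N).

Definition free_hom_fun (x : {freeg X / int}) : N :=
  fglift (h : X -> zmodule N) x.

Lemma free_hom_is_zmod_morphism : zmod_morphism free_hom_fun.
Proof. exact: (@lift_is_additive int X (zmodule N) h). Qed.

HB.instance Definition _ :=
  GRing.isZmodMorphism.Build _ _ free_hom_fun free_hom_is_zmod_morphism.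

Definition free_hom : {additive {freeg X / int} -> N} := free_hom_fun.

Lemma free_homU x : free_hom << x >> = h x.
Proof. by rewrite /free_hom /= /free_hom_fun liftU scale1r. Qed.
End FreeLift.

Lemma free_hom_ext (X : choiceType) (N : zmodType)
    (f g : {additive {freeg X / int} -> N}) :
  (forall x, f << x >> = g << x >>) -> f =1 g.
Proof.
move=> fg x; rewrite -[x]freeg_sumE !raddf_sum; apply: eq_bigr => z _.
have -> : << coeff z x *g z >> = << z >> *~ coeff z x :> {freeg X / int}.
  by rewrite freegU_mulz intz.
by rewrite !raddfMz fg.
Qed.

(* A finite index set is a sequence, which makes the family directed. *)
Lemma gen_sub_compact (V : zmodType) (X : eqType) (T : seq X -> set V) x :
  (forall s s', {subset s <= s'} -> T s `<=` T s')%classic ->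
  x \in gen_sub (\bigcup_s T s)%classic ->
  exists s, x \in gen_sub (T s).
Proof.
move=> Tsub.
have mono s s' : {subset s <= s'} -> {subset gen_sub (T s) <= gen_sub (T s')}.
  move=> ss' y /asboolP yT; apply: yT => t Tst.
  by apply: mem_gen; apply: Tsub Tst.
pose K : {pred V} := fun y => `[< exists s, y \in gen_sub (T s) >].
have Kc : zmod_closed K.
  split; first by apply/asboolP; exists [::]; exact: rpred0.
  move=> y z /asboolP[s ys] /asboolP[t zt]; apply/asboolP; exists (s ++ t).
  apply: rpredB; [apply: mono ys | apply: mono zt] => u;
    by rewrite mem_cat => ->; rewrite ?orbT.
pose KI := GRing.isZmodClosed.Build V K Kc.
pose KK : zmodClosed V := HB.pack K KI.
move=> /asboolP xT; apply/asboolP; apply: (xT KK) => t [s _ Tst].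
by apply/asboolP; exists s; apply: mem_gen.
Qed.

(** A pair [(e, r)] is the equation [phi e = r]. If the span of all equations contains [(0, d)], so
    does the span of finitely many, and their solvability gives [d = 0]. Hence the span is the graph
    of a partial homomorphism, which extends. *)
Lemma linear_system_compact (Y : eqType) (X : choiceType) (N : zmodType)
    (T : seq Y -> set ({freeg X / int} * N)) :
  divisible N ->
  (forall s s', {subset s <= s'} -> T s `<=` T s')%classic ->
  (forall s, exists phi : {additive {freeg X / int} -> N},
     forall e r, T s (e, r) -> phi e = r) ->
  exists phi : {additive {freeg X / int} -> N},
     forall s e r, T s (e, r) -> phi e = r.
Proof.
move=> divN Tsub sol.
pose U := (\bigcup_s T s)%classic.
have [|||phi phiU] := @injective_extension _ _ divN [set p | p \in gen_sub U].
- exact: (rpred0 (gen_sub U)).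
- by move=> p p' /=; exact: rpredB.
- move=> d /= /(gen_sub_compact Tsub)[s ds].
  have [psi psiT] := sol s.
  pose D (p : {freeg X / int} * N) := psi p.1 - p.2.
  have DB : zmod_morphism D.
    by move=> p p'; rewrite /D /= raddfB; zmod.
  pose DM : {additive _ -> N} := HB.pack D (GRing.isZmodMorphism.Build _ _ D DB).
  have : DM (0, d) = 0.
    apply: gen_sub_ker ds => -[e r] /psiT /= er.
    by rewrite /D /= er subrr.
  by rewrite /= /D /= raddf0 sub0r => /eqP; rewrite oppr_eq0 => /eqP.
by exists phi => s e r Ts; apply: phiU; apply: mem_gen; exists s.
Qed.

(** * Abelian 3-cocycles of trace zero *)

Definition trivial_cochain (A N : zmodType) (p : ab_cochain A N) : Prop :=
  exists f, p = ab_coboundary f.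

Definition trace_zero (A N : zmodType) (p : ab_cochain A N) : Prop :=
  forall a, p.2 a a = 0.

Definition trace_injective (A N : zmodType) : Prop :=
  forall p : ab_cochain A N,
    is_ab_cocycle p -> trace_zero p -> trivial_cochain p.

Definition pullback (F A N : zmodType) (pi : F -> A) (p : ab_cochain A N) :
    ab_cochain F N :=
  (fun x y z => p.1 (pi x) (pi y) (pi z), fun x y => p.2 (pi x) (pi y)).

Lemma pullback_cocycle (F A N : zmodType) (pi : {additive F -> A})
    (p : ab_cochain A N) :
  is_ab_cocycle p -> is_ab_cocycle (pullback pi p).
Proof.
by case: p => w c [h1 h2 h3]; split=> * /=; rewrite !raddfD;
  [exact: h1 | exact: h2 | exact: h3].
Qed.

Section Cohomologous.
Variables (A N : zmodType) (p : ab_cochain A N) (f : A -> A -> N).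

Lemma cocycle_sub_coboundary :
  is_ab_cocycle p -> is_ab_cocycle (p - ab_coboundary f).
Proof.
move=> pZ; apply/(@asboolP (is_ab_cocycle _)).
by apply: (rpredB (_ : p \in @Z3ab_pred A N)); [apply/asboolP
  | exact: ab_coboundary_is_cocycle].
Qed.

Lemma trace_zero_sub_coboundary :
  trace_zero p -> trace_zero (p - ab_coboundary f).
Proof. by move=> p0 a; rewrite /= !fctE p0 subrr subrr. Qed.

Lemma trivial_sub_coboundary :
  trivial_cochain (p - ab_coboundary f) -> trivial_cochain p.
Proof.
case=> g pg; exists (g + f); rewrite -[LHS](subrK (ab_coboundary f)) pg.
by congr pair; do ![apply/funext=> ?]; rewrite /= !fctE; zmod.
Qed.
End Cohomologous.

(** For a cocycle, vanishing at 0 in the first and third arguments follows: see [normalized0l] and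
    [normalized0r]. *)
Definition normalized (A N : zmodType) (w : A -> A -> A -> N) : Prop :=
  forall x z, w x 0 z = 0.

Section Normalization.
Variables (A N : zmodType).
Implicit Type p : ab_cochain A N.

Definition normalizer (w : A -> A -> A -> N) (x y : A) : N :=
  (if x == 0 then w 0 0 y else 0) - (if y == 0 then w x 0 0 else 0).

(** At [(x, 0, z)] the coboundary of [f] is [f 0 z - f x 0], while the pentagon at [(x, 0, 0, z)]
    gives [w x 0 z = w 0 0 z + w x 0 0]. The overlap at 0 is harmless because [w 0 0 0 = 0]. *)
Lemma normalizerP p :
  is_ab_cocycle p -> normalized (p - ab_coboundary (normalizer p.1)).1.
Proof.
case: p => w c [h1 h2 h3] x z; rewrite /= !fctE /normalizer !(addr0, add0r).
have w0 : w 0 0 0 = 0 by have := h1 0 0 0 0; rewrite !addr0 subrr add0r subrr add0r.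
rewrite !eqxx; apply: (eq_lin (esym (h1 x 0 0 z))); rewrite !(addr0, add0r).
case: (eqVneq z 0) => [->|_]; case: (eqVneq x 0) => [->|_];
  by rewrite ?w0; zmod.
Qed.

Variables (w : A -> A -> A -> N) (c : A -> A -> N).
Hypotheses (wcZ : is_ab_cocycle (w, c)) (wn : normalized w).

Lemma normalized0l y z : w 0 y z = 0.
Proof.
case: wcZ => h1 _ _; rewrite -(h1 0 0 y z) !(add0r, addr0) !wn; zmod.
Qed.

Lemma normalized0r x y : w x y 0 = 0.
Proof.
case: wcZ => h1 _ _; rewrite -(h1 x y 0 0) !(add0r, addr0) !wn; zmod.
Qed.

Lemma normalized_c0r x : c x 0 = 0.
Proof.
case: wcZ => _ h2 _; rewrite -(h2 x 0 0) !addr0 ?(wn, normalized0l, normalized0r); zmod.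
Qed.
End Normalization.

Section IntSums.
Variable N : zmodType.

(** The negative branch is such that the recurrence [int_sumS] holds on all of [int], with value 0
    at 0. *)
Definition int_sum (h : int -> N) (n : int) : N :=
  match n with
  | Posz k => \sum_(i < k) h i
  | Negz k => - \sum_(i < k.+1) h (Negz i)
  end.

Lemma int_sumS h n : int_sum h (n + 1) = int_sum h n + h n.
Proof.
case: n => [k|[|k]].
- by rewrite -PoszD addn1 /= big_ord_recr.
- by rewrite /= big_ord0 big_ord_recr big_ord0 /= add0r addNr.
- have -> : Negz k.+1 + 1 = Negz k by rewrite !NegzE -addn1 PoszD opprD addrNK.
  by rewrite /= [in RHS]big_ord_recr /= opprD addrNK.
Qed.

Lemma int_arith_progression (s : int -> N) d :
  (forall n, s (n + 1) = s n + d) -> forall n, s n = s 0 + d *~ n.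
Proof.
move=> sS; elim/int_rect => [|n IH|n IH]; first by rewrite mulr0z addr0.
  by rewrite -addn1 PoszD sS IH mulrzDr mulr1z addrA.
apply: (addIr d); rewrite -sS -addn1 PoszD opprD addrNK IH mulrzBr mulr1z.
by rewrite addrA addrNK.
Qed.

Lemma int_periodic (s : int -> N) :
  (forall n, s (n + 1) = s n) -> forall n, s n = s 0.
Proof.
move=> sS n; rewrite (@int_arith_progression s 0) ?mul0rz ?addr0 // => m.
by rewrite sS addr0.
Qed.
End IntSums.

(** * Adding a free generator *)

Section AddGenerator.
Variables (B N : zmodType).

Let G : zmodType := (B * int)%type.
Let t : G := (0, 1).
Let i (b : B) : G := (b, 0).

Let iD a b : i (a + b) = i a + i b. Proof. by []. Qed.
Let pairSr (b : B) (n : int) : (b, n + 1) = (b, n) + t :> G.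
Proof. by apply: injective_projections; rewrite /= ?addr0. Qed.
Let pairSl (b : B) (n : int) : (b, n + 1) = t + (b, n) :> G.
Proof. by rewrite pairSr addrC. Qed.

Definition zero_on_base (p : ab_cochain G N) : Prop :=
  (forall a b d, p.1 (i a) (i b) (i d) = 0) /\ (forall a b, p.2 (i a) (i b) = 0).

(** With [w = 0] the hexagons say that [c] is bilinear, and trace zero makes it alternating. It is
    then determined by the values [c (i b) t] and is an antisymmetrization. *)
Lemma trivial_bilinear (c : G -> G -> N) :
  is_ab_cocycle (0 : G -> G -> G -> N, c) -> trace_zero (0 : G -> G -> G -> N, c) ->
  (forall a b, c (i a) (i b) = 0) -> trivial_cochain (0 : G -> G -> G -> N, c).
Proof.
case=> _ h2 h3 c0 cB.
have z0 x y z : (0 : G -> G -> G -> N) x y z = 0 by [].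
have cr x y z : c x (y + z) = c x y + c x z.
  by apply: (eq_lin (esym (h2 x y z))); rewrite !z0; zmod.
have cl x y z : c (x + y) z = c x z + c y z.
  by apply: (eq_lin (esym (h3 x y z))); rewrite !z0; zmod.
have cA x y : c x y = - c y x.
  have := c0 (x + y); rewrite /= cr !cl; move: (c0 x) (c0 y) => /= -> ->.
  by rewrite add0r addr0 => /eqP; rewrite addrC addr_eq0 => /eqP.
have cE a m b n : c (a, m) (b, n) = c (i a) t *~ n - c (i b) t *~ m.
  rewrite (@int_arith_progression _ (fun n => c (a, m) (b, n)) (c (a, m) t)); last first.
    by move=> k; rewrite pairSr cr.
  rewrite (@int_arith_progression _ (fun m => c (a, m) (b, 0)) (c t (i b))); last first.
    by move=> k; rewrite pairSr cl.
  rewrite (@int_arith_progression _ (fun m => c (a, m) t) (c t t)); last first.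
    by move=> k; rewrite pairSr cl.
  by rewrite -!/(i _) cB (c0 t : c t t = 0) mul0rz addr0 add0r (cA t) mulNrz addrC.
exists (fun x y => c (i x.1) t *~ y.2).
congr pair.
  do ![apply/funext=> ?]; rewrite z0 /= iD cl mulrzDl mulrzDr; zmod.
by apply/funext=> -[a m]; apply/funext=> -[b n]; rewrite cE.
Qed.

Section Strict.
Variables (w : G -> G -> G -> N) (c : G -> G -> N).
Hypotheses (wcZ : is_ab_cocycle (w, c)) (wcB : zero_on_base (w, c)).
Hypotheses (wr : forall x y, w x y t = 0) (wl : forall y z, w t y z = 0).

Let gamma (b : B) : N := c (i b) t.

(** The pentagon with [t] as last or first argument makes [w] insensitive to the integer component
    of its third or first argument. In the second argument a step by [t] adds a fixed amount, which
    the second hexagon at [(a, b, t)] expresses through [gamma]. *)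
Let wE x y z : w x y z =
  (gamma (x.1 + y.1 + z.1) - gamma (y.1 + z.1) - gamma (x.1 + y.1) + gamma y.1)
     *~ y.2.
Proof.
case: wcZ => h1 _ h3; case: wcB => wB _.
have per3 x' y' d n : w x' y' (d, n) = w x' y' (i d).
  apply: (@int_periodic _ (fun n => w x' y' (d, n))) => {}n; rewrite pairSr.
  by apply: (eq_lin (esym (h1 x' y' (d, n) t))); rewrite !wr; zmod.
have per1 a n y' z' : w (a, n) y' z' = w (i a) y' z'.
  apply: (@int_periodic _ (fun n => w (a, n) y' z')) => {}n; rewrite pairSl.
  by apply: (eq_lin (esym (h1 t (a, n) y' z'))); rewrite !wl; zmod.
have hexE a b : w (i a) t (i b) = gamma (a + b) - gamma a - gamma b.
  by apply: (eq_lin (h3 (i a) (i b) t)); rewrite wr wl /gamma iD; zmod.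
case: x y z => [a m] [b n] [d l] /=; rewrite per3 per1.
rewrite (@int_arith_progression _ (fun n => w (i a) (b, n) (i d))
   (w (i a) t (i (b + d)) - w (i a) t (i b))); last first.
  move=> k; rewrite pairSl -(per3 _ _ (b + d) k) -(per3 _ _ b k).
  have -> : (b + d, k) = (b, k) + i d :> G.
    by apply: injective_projections; rewrite /= ?addr0.
  apply: (eq_lin (h1 (i a) t (b, k) (i d))).
  have -> : i a + t = (a, 1) by apply: injective_projections; rewrite /= ?(add0r,addr0).
  by rewrite wl (per1 a 1); zmod.
rewrite /= -/(i b) (wB _ _ _ : w _ _ _ = 0) add0r !hexE; congr (_ *~ _); rewrite addrA; zmod.
Qed.

Lemma trivial_strict : trace_zero (w, c) -> trivial_cochain (w, c).
Proof.
move=> wc0.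
(* By [wE], the coboundary of this [f] has first component [w], and [f] vanishes on the base;
   [trivial_bilinear] treats what is left. *)
pose f (x y : G) := (gamma (x.1 + y.1) - gamma y.1) *~ y.2.
have w0 : (w, c) - ab_coboundary f = (0, c - (ab_coboundary f).2).
  congr pair; apply/funext=> x; apply/funext=> y; apply/funext=> z.
  rewrite /= !fctE wE /f /= !addrA !(mulrzDr, mulrzBl, mulrzDl); zmod.
apply: (@trivial_sub_coboundary _ _ _ f); rewrite w0.
apply: trivial_bilinear; rewrite -?w0.
- exact: cocycle_sub_coboundary.
- exact: trace_zero_sub_coboundary.
- by case: wcB => _ cB a b; rewrite !fctE (cB a b : c _ _ = 0) /= /f /= !mulr0z !subrr.
Qed.
End Strict.

(** [h] solves [h (t + x) b = h x b - w t x (i b)], so subtracting the coboundary of [f] kills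
    [w t y z]. As [f x y] sees only the base component of [y] and [h x 0 = 0], that coboundary
    vanishes when its last argument is [t], and the strictness already achieved survives. *)
Lemma trivial_left_strict (p : ab_cochain G N) :
  is_ab_cocycle p -> trace_zero p -> zero_on_base p -> normalized p.1 ->
  (forall x y, p.1 x y t = 0) -> trivial_cochain p.
Proof.
case: p => w c wcZ wc0 wcB wn /= wr.
pose h (x : G) (b : B) := int_sum (fun m => - w t (x.1, m) (i b)) x.2.
pose f (x y : G) := h x y.1.
have hS x b : h (t + x) b = h x b - w t x (i b).
  by case: x => a m; rewrite -pairSl /h /= int_sumS.
have h0 b : h 0 b = 0 by rewrite /h /= big_ord0.
have ht b : h t b = 0 by rewrite -[t]addr0 hS h0 (wn t (i b) : w _ _ _ = 0) subr0.
have hi a b : h (i a) b = 0 by rewrite /h /= big_ord0.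
have hn x : h x 0 = 0.
  case: x => a m; rewrite (@int_periodic _ (fun m => h (a, m) 0)) ?hi // => k.
  by rewrite pairSl hS (normalized0r wcZ wn) subr0.
have fi a b : f (i a) (i b) = 0 by rewrite /f hi.
have wr' x y : (((w, c) : ab_cochain G N) - ab_coboundary f).1 x y t = 0.
  by rewrite /= !fctE wr /f /= !addr0 !hn; zmod.
apply: (@trivial_sub_coboundary _ _ _ f).
move: wr'; case E : (((w, c) : ab_cochain G N) - ab_coboundary f) => [w' c'] /= wr'.
have wZ' : is_ab_cocycle (w', c') by rewrite -E; exact: cocycle_sub_coboundary.
have per3 x y d n : w' x y (d, n) = w' x y (i d).
  apply: (@int_periodic _ (fun n => w' x y (d, n))) => {}n; rewrite pairSr.
  case: wZ' => h1 _ _.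
  by apply: (eq_lin (esym (h1 x y (d, n) t))); rewrite !wr'; zmod.
have [w'E c'E] : w' = w - (ab_coboundary f).1 /\ c' = c - (ab_coboundary f).2.
  by case: E.
apply: trivial_strict => //.
- split=> [a b d|a b] /=; rewrite (w'E, c'E) !fctE.
    by rewrite (wcB.1 a b d : w _ _ _ = 0) /= -!iD !fi; zmod.
  by rewrite (wcB.2 a b : c _ _ = 0) /= !fi; zmod.
- move=> y [d n]; rewrite per3 w'E !fctE /= /f /= ht hS ht; zmod.
- by rewrite -E; exact: trace_zero_sub_coboundary.
Qed.

(** [f] solves [f x (y + t) = f x y + w x y t] and vanishes at [y = t], so its coboundary agrees
    with [w] when the last argument is [t]. *)
Lemma trivial_normalized (p : ab_cochain G N) :
  is_ab_cocycle p -> trace_zero p -> zero_on_base p -> normalized p.1 ->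
  trivial_cochain p.
Proof.
case: p => w c wcZ wc0 wcB wn.
pose f (x y : G) := int_sum (fun n => w x (y.1, n) t) y.2.
have fS x y : f x (y + t) = f x y + w x y t.
  by case: y => b n; rewrite -pairSr /f /= int_sumS.
have fi x b : f x (i b) = 0 by rewrite /f /= big_ord0.
have f0r x : f x 0 = 0 by exact: fi.
have ft x : f x t = 0 by rewrite -[t]add0r fS f0r (wn x t : w _ _ _ = 0) addr0.
have f0l y : f 0 y = 0.
  case: y => b n; rewrite (@int_periodic _ (fun n => f 0 (b, n))) ?fi // => k.
  by rewrite pairSr fS (normalized0l wcZ wn) addr0.
apply: (@trivial_sub_coboundary _ _ _ f); apply: trivial_left_strict.
- exact: cocycle_sub_coboundary.
- exact: trace_zero_sub_coboundary.
- split=> [a b d|a b] /=; rewrite !fctE.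
    by rewrite (wcB.1 a b d : w _ _ _ = 0) -!iD !fi; zmod.
  by rewrite (wcB.2 a b : c _ _ = 0) !fi; zmod.
- by move=> x z; rewrite /= !fctE (wn x z : w x 0 z = 0) f0l f0r add0r; zmod.
- by move=> x y; rewrite /= !fctE fS !ft; zmod.
Qed.

Lemma trace_injective_add_generator :
  trace_injective B N -> trace_injective G N.
Proof.
move=> injB p pZ p0.
pose iM : {additive B -> G} :=
  HB.pack i (GRing.isZmodMorphism.Build _ _ i (fun a b => erefl : i (a - b) = i a - i b)).
have [f pf] := injB _ (pullback_cocycle iM pZ) (fun a => p0 (i a)).
(* The trivialization over [B] is extended along the projection to [B]. *)
pose g (x y : G) := f x.1 y.1.
apply: (@trivial_sub_coboundary _ _ _ g).
have := cocycle_sub_coboundary g pZ; have := trace_zero_sub_coboundary g p0.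
have : zero_on_base (p - ab_coboundary g).
  split=> [a b d|a b] /=; rewrite !fctE.
    have := congr1 (fun q => q.1 a b d) pf; rewrite /= => ->; exact: subrr.
  have := congr1 (fun q => q.2 a b) pf; rewrite /= => ->; exact: subrr.
move: (p - _) => {p pZ p0 pf} p pB p0 pZ.
have nB a b : normalizer p.1 (i a) (i b) = 0.
  rewrite /normalizer (pB.1 0 0 b : p.1 0 0 (i b) = 0) (pB.1 a 0 0 : p.1 (i a) 0 0 = 0).
  by rewrite !if_same subrr.
apply: (@trivial_sub_coboundary _ _ _ (normalizer p.1)).
apply: trivial_normalized.
- exact: cocycle_sub_coboundary.
- exact: trace_zero_sub_coboundary.
- split=> [a b d|a b] /=; rewrite !fctE.
    by rewrite pB.1 -!iD !nB; zmod.
  by rewrite pB.2 !nB; zmod.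
- exact: normalizerP.
Qed.
End AddGenerator.

(** * Descent to the image of a homomorphism *)

Section Kernel.
Variables (F A : zmodType) (pi : {additive F -> A}).

Definition ker_pred : {pred F} := fun x => pi x == 0.

Lemma ker_pred_closed : zmod_closed ker_pred.
Proof.
split; first by rewrite unfold_in raddf0.
by move=> x y; rewrite !unfold_in raddfB => /eqP-> /eqP->; rewrite subr0.
Qed.

HB.instance Definition _ := GRing.isZmodClosed.Build F ker_pred ker_pred_closed.

Record ker := MkKer { ker_val : F; kerP : ker_val \in ker_pred }.

HB.instance Definition _ := [isSub for ker_val].
HB.instance Definition _ := [Choice of ker by <:].
HB.instance Definition _ := [SubChoice_isSubZmodule of ker by <:].

Definition ker_incl : {additive ker -> F} := \val.

Lemma ker_inclP k : pi (ker_incl k) = 0.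
Proof. exact/eqP/(kerP k). Qed.

Lemma ker_lift x : pi x = 0 -> exists k, ker_incl k = x.
Proof. by move=> /eqP px; exists (MkKer (px : x \in ker_pred)). Qed.

Lemma ker_extend (T : Type) (h : ker -> T) :
  exists h' : F -> T, forall k, h' (ker_incl k) = h k.
Proof.
exists (fun x => h (insubd 0 x)) => k; congr h.
by apply: val_inj; rewrite val_insubd (kerP k).
Qed.
End Kernel.

Section Descent.
Variables (F A N : zmodType) (pi : {additive F -> A}).
Hypotheses (divN : divisible N) (injF : trace_injective F N).

Definition coboundary_at (p : ab_cochain A N) (f : A -> A -> N) (S : set A) :=
  (forall x y z, S x -> S y -> S z -> p.1 x y z = (ab_coboundary f).1 x y z) /\
  (forall x y, S x -> S y -> p.2 x y = (ab_coboundary f).2 x y).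

(** On the kernel the normalized [w] and [c] pull back to 0, so there [f] is a symmetric 2-cocycle
    and splits. Subtracting the coboundary of any extension of the splitting to [F] changes neither
    component of [ab_coboundary f]. *)
Lemma trivialization_zero_on_kernel (w : A -> A -> A -> N) c f :
  is_ab_cocycle (w, c) -> normalized w -> pullback pi (w, c) = ab_coboundary f ->
  exists f1 : F -> F -> N, [/\ pullback pi (w, c) = ab_coboundary f1,
     forall x, f1 x 0 = 0 & forall k l, pi k = 0 -> pi l = 0 -> f1 k l = 0].
Proof.
move=> wcZ wn pf.
have fw x y z : w (pi x) (pi y) (pi z) = f y z - f (x + y) z + f x (y + z) - f x y.
  exact: (congr1 (fun q => q.1 x y z) pf).
have fc x y : c (pi x) (pi y) = f x y - f y x.
  exact: (congr1 (fun q => q.2 x y) pf).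
have [||g fg] := @sym_cocycle_split (ker pi) N
  (fun k l => f (ker_incl pi k) (ker_incl pi l)) _ _ divN.
- by move=> x y z; rewrite !raddfD -fw !ker_inclP wn.
- by move=> x y; apply/subr0_eq; rewrite -fc !ker_inclP (normalized_c0r wcZ wn).
have [g' g'g] := ker_extend g.
pose f1 x y := f x y - g' x - g' y + g' (x + y).
have f1w x y z : w (pi x) (pi y) (pi z) = f1 y z - f1 (x + y) z + f1 x (y + z) - f1 x y.
  by rewrite fw /f1 addrA; zmod.
have f1c x y : c (pi x) (pi y) = f1 x y - f1 y x.
  by rewrite fc /f1 [y + x]addrC; zmod.
have f10 k l : pi k = 0 -> pi l = 0 -> f1 k l = 0.
  move=> /ker_lift[{}k <-] /ker_lift[{}l <-].
  by rewrite /f1 -raddfD !g'g fg; zmod.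
exists f1; split => //.
- by congr pair; do ![apply/funext=> ?].
- move=> x; have := f1w x 0 0; rewrite !raddf0 (normalized0r wcZ wn) !addr0.
  by rewrite f10 ?raddf0 // => /esym h; apply: (eq_lin (esym h)); zmod.
Qed.

Lemma descent_normalized (w : A -> A -> A -> N) c :
  is_ab_cocycle (w, c) -> trace_zero (w, c) -> normalized w ->
  exists f, coboundary_at (w, c) f (range pi).
Proof.
move=> wcZ wc0 wn.
have [f pf] := injF (pullback_cocycle pi wcZ) (fun a => wc0 (pi a)).
have [f1 [pf1 f1r f1K]] := trivialization_zero_on_kernel wcZ wn pf.
(* [pi] need not be onto: [s] is a section over its image only. *)
have [s sK] : exists s : A -> F, forall x, pi (s (pi x)) = pi x.
  exists (fun a => xget 0 [set x | pi x = a]) => x.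
  exact: (@xgetPex _ 0 [set y | pi y = pi x] (ex_intro _ x erefl)).
pose r x := s (pi x).
have rK x : pi (r x) = pi x by exact: sK.
have rD x k : pi k = 0 -> r (x + k) = r x by move=> k0; rewrite /r raddfD k0 addr0.
(* This correction makes [f2 (r x) k = 0] for [k] in the kernel. The identity for [w] then gives
   [f2 x l = 0], the one for [c] gives [f2 l x = 0], and so [f2] is invariant under the kernel in
   both arguments and descends. *)
pose g x := f1 (r x) (x - r x).
pose f2 x y := f1 x y + g x + g y - g (x + y).
have f2w x y z : w (pi x) (pi y) (pi z) = f2 y z - f2 (x + y) z + f2 x (y + z) - f2 x y.
  rewrite (congr1 (fun q => q.1 x y z) pf1 : w _ _ _ = _) /f2 /= addrA; zmod.
have f2c x y : c (pi x) (pi y) = f2 x y - f2 y x.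
  by rewrite (congr1 (fun q => q.2 x y) pf1 : c _ _ = _) /f2 [y + x]addrC /=; zmod.
have gK k : pi k = 0 -> g k = 0.
  by move=> k0; apply: f1K; rewrite ?raddfB rK k0 ?subrr.
have gr x : g (r x) = 0.
  have rr : r (r x) = r x by rewrite {1}/r rK.
  by rewrite /g rr subrr f1r.
have f2r x k : pi k = 0 -> f2 (r x) k = 0.
  move=> k0; rewrite /f2 gr gK // {1}/g rD // .
  have rr : r (r x) = r x by rewrite {1}/r rK.
  by rewrite rr [r x + k]addrC addrK; zmod.
have f2K k l : pi k = 0 -> pi l = 0 -> f2 k l = 0.
  by move=> k0 l0; rewrite /f2 f1K // !gK ?raddfD ?k0 ?l0 ?addr0 //; zmod.
have f2x0 x l : pi l = 0 -> f2 x l = 0.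
  move=> l0; pose k := x - r x.
  have k0 : pi k = 0 by rewrite raddfB rK subrr.
  have xE : r x + k = x by rewrite /k addrC subrK.
  have kl0 : pi (k + l) = 0 by rewrite raddfD k0 l0 addr0.
  have := f2w (r x) k l; rewrite l0 k0 wn (f2K k l) // (f2r x k) // (f2r x _ kl0) xE.
  by move=> h; apply: (eq_lin h); zmod.
have f20x x l : pi l = 0 -> f2 l x = 0.
  move=> l0; have := f2c x l; rewrite l0 (normalized_c0r wcZ wn) f2x0 //.
  by rewrite sub0r => /esym/eqP; rewrite oppr_eq0 => /eqP.
have f2Dr x y l : pi l = 0 -> f2 x (y + l) = f2 x y.
  move=> l0; have := f2w x y l; rewrite l0 (normalized0r wcZ wn) !(f2x0 _ l) //.
  by move=> h; apply: (eq_lin (esym h)); zmod.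
have f2Dl x y l : pi l = 0 -> f2 (x + l) y = f2 x y.
  move=> l0; have := f2w l x y; rewrite l0 (normalized0l wcZ wn) !(f20x _ l) // addrC.
  by rewrite [l + x]addrC => h; apply: (eq_lin h); zmod.
have f2s x x' y y' : pi x = pi x' -> pi y = pi y' -> f2 x y = f2 x' y'.
  move=> xx' yy'; rewrite -(subrK x' x) -(subrK y' y) addrC [_ + y']addrC.
  by rewrite f2Dl ?f2Dr // raddfB ?xx' ?yy' subrr.
exists (fun a b => f2 (s a) (s b)).
split=> [_ _ _ [x _ <-] [y _ <-] [z _ <-]|_ _ [x _ <-] [y _ <-]] /=.
  rewrite f2w -!raddfD; congr (_ - _ + _ - _); apply: f2s; by rewrite !sK.
by rewrite f2c; congr (_ - _); apply: f2s; rewrite sK.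
Qed.

Lemma descent (p : ab_cochain A N) :
  is_ab_cocycle p -> trace_zero p -> exists f, coboundary_at p f (range pi).
Proof.
move=> pZ p0; pose q := p - ab_coboundary (normalizer p.1).
have qZ : is_ab_cocycle q by exact: cocycle_sub_coboundary.
have q0 : trace_zero q by exact: trace_zero_sub_coboundary.
have qn : normalized q.1 by exact: normalizerP.
have pE : p = q + ab_coboundary (normalizer p.1) by rewrite /q subrK.
move: pE q0 qZ qn; move: (normalizer _) => n; case: q => w c -> q0 qZ qn.
have [f [fw fc]] := descent_normalized qZ q0 qn.
exists (f + n); split=> [x y z Sx Sy Sz|x y Sx Sy].
  by rewrite /= !fctE (fw _ _ _ Sx Sy Sz : w _ _ _ = _) /=; zmod.
by rewrite /= !fctE (fc _ _ Sx Sy : c _ _ = _) /=; zmod.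
Qed.
End Descent.

(** * From finite subsets to the whole group *)

Lemma trace_injective_zero (N : zmodType) : trace_injective 'rV[int]_0 N.
Proof.
move=> [w c] [h1 _ _] /= c0; exists (fun _ _ => 0).
have w0 : w 0 0 0 = 0 by have := h1 0 0 0 0; rewrite !addr0 subrr add0r subrr add0r.
congr pair; apply/funext=> x; apply/funext=> y; last first.
  by rewrite (thinmx0 x) (thinmx0 y) (c0 0 : c 0 0 = 0) /= subrr.
by apply/funext=> z; rewrite (thinmx0 x) (thinmx0 y) (thinmx0 z) w0 /= !subr0 addr0.
Qed.

(** Starting from the zero group ['rV[int]_0], each entry of [S] adds a copy of the integers whose
    generator is sent to it. *)
Lemma finite_cover (A N : zmodType) (S : seq A) :
  exists (F : zmodType) (pi : {additive F -> A}),
    trace_injective F N /\ forall x, x \in S -> exists y, pi y = x.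
Proof.
elim: S => [|a S [F [pi [injF piS]]]].
  by exists 'rV[int]_0, 0; split; first exact: trace_injective_zero.
pose pi' (x : F * int) := pi x.1 + a *~ x.2.
have pi'B : zmod_morphism pi'.
  by move=> [x m] [y n]; rewrite /pi' /= raddfB mulrzBr; zmod.
pose pi'M : {additive _ -> A} := HB.pack pi' (GRing.isZmodMorphism.Build _ _ pi' pi'B).
exists (F * int)%type, pi'M; split; first exact: trace_injective_add_generator.
move=> x; rewrite inE => /orP[/eqP->|/piS[y <-]].
  by exists (0, 1); rewrite /= /pi' /= raddf0 add0r mulr1z.
by exists (y, 0); rewrite /= /pi' /= mulr0z addr0.
Qed.

Theorem divisible_trace_injective (A N : zmodType) :
  divisible N -> trace_injective A N.
Proof.
move=> divN p pZ p0.
pose E := {freeg (A * A) / int}.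
(* The unknowns are the values [f x y], one generator of [E] each; [T S] holds the equations
   [p = ab_coboundary f] at arguments in [S]. *)
pose u (x y : A) : E := << (x, y) >>.
pose T (S : seq A) : set (E * N) := fun q =>
  (exists x y z, [/\ x \in S, y \in S & z \in S] /\
     q = (u y z - u (x + y) z + u x (y + z) - u x y, p.1 x y z)) \/
  (exists x y, (x \in S /\ y \in S) /\ q = (u x y - u y x, p.2 x y)).
have [||phi phiT] := @linear_system_compact A _ N T divN.
- move=> S S' SS' q [[x [y [z [[xS yS zS] ->]]]]|[x [y [[xS yS] ->]]]].
    by left; exists x, y, z; split=> //; split; exact: SS'.
  by right; exists x, y; split=> //; split; exact: SS'.
- move=> S; have [F [pi [injF piS]]] := finite_cover N S.
  have [f [fw fc]] := descent pi divN injF pZ p0.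
  have imS x : x \in S -> range pi x by move=> /piS[y <-]; exists y.
  exists (free_hom (fun q => f q.1 q.2)) => e r.
  case=> [[x [y [z [[/imS xS /imS yS /imS zS] [-> ->]]]]]|[x [y [[/imS xS /imS yS] [-> ->]]]]].
    by rewrite !(raddfB, raddfD) /= !free_homU fw.
  by rewrite !raddfB /= !free_homU fc.
exists (fun x y => phi (u x y)).
rewrite [p]surjective_pairing; congr pair.
  apply/funext=> x; apply/funext=> y; apply/funext=> z.
  rewrite -!(raddfB, raddfD); symmetry; apply: (phiT [:: x; y; z]); left.
  by exists x, y, z; rewrite !inE !eqxx !orbT.
apply/funext=> x; apply/funext=> y.
rewrite -!raddfB; symmetry; apply: (phiT [:: x; y]); right.
by exists x, y; rewrite !inE !eqxx !orbT.
Qed.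

(** * Surjectivity of the trace and of the polarization *)

Section BiadditiveMaps.
Variables (U V N : zmodType) (beta : U -> V -> N).
Hypothesis betaB : biadditive beta.

Lemma biadditive_left_additive v : zmod_morphism (fun u => beta u v).
Proof.
by move=> u u'; apply: (addIr (beta u' v)); rewrite -betaB.1 !subrK.
Qed.

Lemma biadditive_right_additive u : zmod_morphism (beta u).
Proof.
by move=> v v'; apply: (addIr (beta u v')); rewrite -betaB.2 !subrK.
Qed.

Definition biadditive_left v : {additive U -> N} :=
  HB.pack (fun u => beta u v)
    (GRing.isZmodMorphism.Build _ _ (fun u => beta u v) (biadditive_left_additive v)).

Definition biadditive_right u : {additive V -> N} :=
  HB.pack (beta u)
    (GRing.isZmodMorphism.Build _ _ (beta u) (biadditive_right_additive u)).

Lemma biadditive0l v : beta 0 v = 0.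
Proof. exact: (raddf0 (biadditive_left v)). Qed.
End BiadditiveMaps.

Section FreeBiadditive.
Variables (X : choiceType) (N : zmodType).
Let F := {freeg X / int}.

Lemma biadditive_free_ext (beta beta' : F -> F -> N) :
  biadditive beta -> biadditive beta' ->
  (forall a b, beta << a >> << b >> = beta' << a >> << b >>) ->
  forall x y, beta x y = beta' x y.
Proof.
move=> bB bB' bb' x y.
have gen a : beta << a >> y = beta' << a >> y.
  have := @free_hom_ext X N (biadditive_right bB << a >>) (biadditive_right bB' << a >>).
  by move=> /(_ (bb' a) y).
exact: (@free_hom_ext X N (biadditive_left bB y) (biadditive_left bB' y) gen x).
Qed.

Definition free_bilinear (h : X -> X -> N) (x y : F) : N :=
  free_hom (fun a => free_hom (h a) y) x.

Lemma free_bilinearU h a b : free_bilinear h << a >> << b >> = h a b.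
Proof. by rewrite /free_bilinear !free_homU. Qed.

Lemma free_bilinear_biadditive h : biadditive (free_bilinear h).
Proof.
split=> [x x' y|x y y']; rewrite /free_bilinear ?raddfD //.
apply: (@free_hom_ext X N _ (free_hom _ + free_hom _ : {additive F -> N})) => a.
by rewrite homDE !free_homU raddfD.
Qed.
End FreeBiadditive.

Lemma biadditive_cocycle (U N : zmodType) (c : U -> U -> N) :
  biadditive c -> is_ab_cocycle (fun _ _ _ => 0, c).
Proof.
move=> [cl cr]; split=> *; rewrite ?(cl, cr) ?(addr0, subr0) //; zmod.
Qed.

Lemma quadratic0 (A N : zmodType) (q : Quad A N) : q 0 = 0.
Proof.
have := biadditive0l (polar_biadditive q) 0.
by rewrite /polar addr0 subrr sub0r => /eqP; rewrite oppr_eq0 => /eqP.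
Qed.

Section TraceSurjective.
Variables (A N : zmodType) (q : Quad A N).
Hypothesis divN : divisible N.

Let F : zmodType := {freeg A / int}.
Let pi : {additive F -> A} := free_hom id.
Let s (a : A) : F := << a >>.
Let pis a : pi (s a) = a. Proof. exact: free_homU. Qed.

(** On generators [c a a] is [q a], and off the diagonal [c a b] is a chosen half of [polar q a b];
    [half] need not be additive. The symmetrization is compared on generators, the diagonal case
    being [q (a + a) = q a *+ 4]. Then [c x x - q (pi x)] is additive and vanishes on generators. *)
Lemma quadratic_diagonal : exists c : F -> F -> N,
  [/\ biadditive c, forall x y, c x y + c y x = polar q (pi x) (pi y)
    & forall x, c x x = q (pi x)].
Proof.
have [half halfE] : exists half : N -> N, forall x, half x *+ 2 = x.
  exists (fun x => projT1 (cid (divN x (isT : (0 < 2)%N)))) => x.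
  by case: cid.
pose h a b := if a == b then q a else half (polar q a b).
pose c := free_bilinear h.
have cB : biadditive c := free_bilinear_biadditive h.
have pB := polar_biadditive q.
have qD a : q (a + a) = q a *+ 4.
  have [qN qQ] := asboolP _ (quadP q).
  have := qQ a a (- a); rewrite -qN subrr addrK !quadratic0.
  by move=> E; apply: (eq_lin (esym E)); rewrite !mulrS mulr0n; zmod.
have csym x y : c x y + c y x = polar q (pi x) (pi y).
  apply: (@biadditive_free_ext _ _ (fun x y => c x y + c y x)
    (fun x y => polar q (pi x) (pi y))) => [||a b].
  - by split=> x1 x2 x3; rewrite !(cB.1, cB.2) addrACA.
  - by split=> x1 x2 x3; rewrite raddfD (pB.1, pB.2).
  rewrite /c !free_bilinearU !pis /h [b == a]eq_sym.
  case: eqVneq => [->|_]; last by rewrite [polar q b a]polarC -mulr2n halfE.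
  by rewrite /polar qD !mulrS mulr0n; zmod.
exists c; split=> // x; apply/subr0_eq.
pose D x := c x x - q (pi x).
have DB : zmod_morphism D.
  have DD y z : D (y + z) = D y + D z.
    rewrite /D !(cB.1, cB.2) raddfD.
    by apply: (eq_lin (csym y z)); rewrite /polar; zmod.
  by move=> y z; apply: (addIr (D z)); rewrite -DD !subrK.
pose DM : {additive F -> N} := HB.pack D (GRing.isZmodMorphism.Build _ _ D DB).
apply: (@free_hom_ext _ _ DM 0) => a.
by rewrite /= /D /c free_bilinearU /h eqxx pis subrr.
Qed.

(* Associativity constraint transported to A along the section s: c moves
   kappa x y past s z, and g multiplies the two resulting elements of K. *)
Lemma descended_cocycle (K : zmodType) (i : {additive K -> F})
    (c : F -> F -> N) (g : K -> K -> N) (kappa : A -> A -> K) :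
  biadditive c -> is_2cocycle g ->
  (forall k l, c (i k) (i l) = g k l - g l k) ->
  (forall k x, c x (i k) = - c (i k) x) ->
  injective i -> (forall x y, i (kappa x y) = s x + s y - s (x + y)) ->
  is_ab_cocycle
    (fun x y z => c (i (kappa x y)) (s z) + g (kappa (x + y) z) (kappa x y)
                  - g (kappa x (y + z)) (kappa y z),
     fun x y => c (s x) (s y)).
Proof.
move=> cB gZ cg cN i_inj kE.
have cl x y z : c (x - y) z = c x z - c y z by exact: biadditive_left_additive.
have cr x y z : c x (y - z) = c x y - c x z by exact: biadditive_right_additive.
have kC x y : kappa x y = kappa y x by apply: i_inj; rewrite !kE (addrC x) (addrC (s x)).
have kZ x y z : kappa (x + y) z + kappa x y = kappa x (y + z) + kappa y z.
  by apply: i_inj; rewrite !raddfD !kE addrA; zmod.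
have gE k l m : g k l + g (k + l) m = g l m + g k (l + m).
  by apply: (eq_lin (esym (gZ k l m))); zmod.
split=> [x y z t|x y z|x y z].
(* By [E1] and [E2] the [c]-terms of the pentagon reduce to the commutator of [g] at [kappa x y] and
   [kappa z t]. The [g]-terms cancel it: [G1] to [G4] regroup them along [P1] to [P4], and [G5],
   [G6] interchange these two elements. *)
- have E1 : c (i (kappa y z)) (s t) - c (i (kappa (x + y) z)) (s t)
      + c (i (kappa x (y + z))) (s t) = c (i (kappa x y)) (s t).
    have -> : kappa x y = kappa y z - kappa (x + y) z + kappa x (y + z).
      by apply: (eq_lin (kZ x y z)); zmod.
    by rewrite raddfD raddfB cB.1 cl.
  have E2 : c (i (kappa x y)) (s z) + c (i (kappa x y)) (s t)
      - c (i (kappa x y)) (s (z + t)) = g (kappa x y) (kappa z t) - g (kappa z t) (kappa x y).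
    by rewrite -cg (kE z t) cr cB.2.
  have P1 : kappa (x + y + z) t + kappa (x + y) z = kappa (x + y) (z + t) + kappa z t.
    exact: kZ.
  have P2 : kappa (x + y + z) t + kappa x (y + z) =
      kappa x (y + z + t) + kappa (y + z) t by rewrite -addrA kZ.
  have P3 : kappa (y + z) t + kappa y z = kappa y (z + t) + kappa z t by exact: kZ.
  have P4 : kappa x (y + z + t) + kappa y (z + t) = kappa (x + y) (z + t) + kappa x y.
    by rewrite -addrA -kZ.
  have G1 := gE (kappa (x + y + z) t) (kappa (x + y) z) (kappa x y).
  have G2 := gE (kappa (x + y + z) t) (kappa x (y + z)) (kappa y z).
  have G3 := gE (kappa x (y + z + t)) (kappa (y + z) t) (kappa y z).
  have G4 := gE (kappa x (y + z + t)) (kappa y (z + t)) (kappa z t).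
  have G5 := gE (kappa (x + y) (z + t)) (kappa z t) (kappa x y).
  have G6 := gE (kappa (x + y) (z + t)) (kappa x y) (kappa z t).
  rewrite P1 kZ in G1; rewrite P2 in G2; rewrite P3 in G3; rewrite P4 in G4.
  rewrite [kappa z t + _]addrC in G5.
  rewrite ?addrA in E1 E2 G1 G2 G3 G4 G5 G6 *.
  apply: (eq_lin E1); apply: (eq_lin E2).
  apply: (eq_lin (esym G1)); apply: (eq_lin G2); apply: (eq_lin (esym G3)).
  by apply: (eq_lin G4); apply: (eq_lin G5); apply: (eq_lin (esym G6)); zmod.
- have E : c (s x) (s z) - c (s x) (s (y + z)) + c (s x) (s y) =
      - c (i (kappa y z)) (s x).
    by rewrite -cN kE cr cB.2; zmod.
  by apply: (eq_lin E); rewrite (kC y x) (kC z x) (kC (y + z) x) (addrC y x) (addrC z x); zmod.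
- have E : c (s y) (s z) - c (s (x + y)) (s z) + c (s x) (s z) =
      c (i (kappa x y)) (s z).
    by rewrite kE cl cB.1; zmod.
  apply: (eq_lin E); rewrite (kC z x) (kC z y) (addrC z x) (addrC z y).
  by rewrite (kC (x + y) z) (addrC x z) addrC; zmod.
Qed.

Lemma trace_surjective : exists c : ab_cochain A N,
  is_ab_cocycle c /\ forall a, c.2 a a = q a.
Proof.
have [c [cB csym cdiag]] := quadratic_diagonal.
have polar0 k x : pi k = 0 -> polar q (pi k) (pi x) = 0.
  by move=> ->; exact: (biadditive0l (polar_biadditive q)).
pose K := ker pi; pose i : {additive K -> F} := ker_incl pi.
(* [c] is alternating on [K] because [q 0 = 0]. In the resulting equality, the first component says
   that [g] is a 2-cocycle, the second that its commutator is [c]. *)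
have [|k|g [/= gw gc]] := @divisible_trace_injective K N divN
    (pullback i (fun _ _ _ => 0, c)).
- exact: pullback_cocycle (biadditive_cocycle cB).
- by rewrite /= cdiag ker_inclP quadratic0.
have kappaP a b : exists k, i k = s a + s b - s (a + b).
  by apply: ker_lift; rewrite raddfB raddfD !pis subrr.
pose kappa a b := projT1 (cid (kappaP a b)).
exists (fun x y z => c (i (kappa x y)) (s z) + g (kappa (x + y) z) (kappa x y)
                  - g (kappa x (y + z)) (kappa y z), fun x y => c (s x) (s y)).
split; last by move=> a /=; rewrite cdiag pis.
apply: descended_cocycle => //.
- by move=> x y z; rewrite -[LHS](congr1 (fun h => h x y z) gw).
- by move=> k l; exact: (congr1 (fun h => h k l) gc).
- move=> k x; apply/eqP; rewrite -addr_eq0 addrC csym polar0 //.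
  exact: ker_inclP.
- by move=> x y; rewrite /kappa; case: cid.
Qed.
End TraceSurjective.

Section PolarSurjective.
Variables (A N : zmodType) (beta : A -> A -> N).
Hypotheses (divN : divisible N) (bB : biadditive beta).
Hypothesis bC : forall a b, beta a b = beta b a.

(** Since [l] kills the 2-torsion, [a *+ 2] determines [l a]; this homomorphism on doubles extends
    to [A]. *)
Lemma even_part (l : {additive A -> N}) :
  (forall a, a *+ 2 = 0 -> l a = 0) -> exists g : {additive A -> N}, forall a, l a = g a *+ 2.
Proof.
move=> l2.
have [|||g gP] := @injective_extension A N divN
    [set p | exists a, p = (a *+ 2, l a)].
- by exists 0; rewrite mul0rn raddf0.
- by move=> _ _ [a ->] [b ->]; exists (a - b); rewrite mulrnBl raddfB.
- by move=> d [a [/esym /l2 la ->]].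
by exists g => a; rewrite -raddfMn; apply/esym/gP; exists a.
Qed.

Lemma polar_surjective : exists q : Quad A N, forall a b, polar q a b = beta a b.
Proof.
have bZ : is_2cocycle (fun a b => - beta a b).
  by move=> x y z; rewrite bB.1 bB.2; zmod.
have [|q0 q0P] := sym_cocycle_split bZ _ divN; first by move=> a b; rewrite bC.
have q0D a b : q0 (a + b) = q0 a + q0 b + beta a b.
  by apply: (eq_lin (q0P a b)); zmod.
have b0 a : beta 0 a = 0 by exact: biadditive0l bB _.
have q00 : q0 0 = 0.
  have := q0D 0 0; rewrite addr0 b0 => E.
  by apply: (eq_lin (esym E)); zmod.
have bN a b : beta a (- b) = - beta a b by exact: (raddfN (biadditive_right bB a)).
(* q0 is even up to the homomorphism l, which has to be halved. *)
pose l a := beta a a - q0 a *+ 2.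
have lB : zmod_morphism l.
  have lD a b : l (a + b) = l a + l b.
    by rewrite /l q0D bB.1 !bB.2 (bC b a) !mulr2n; zmod.
  by move=> a b; apply: (addIr (l b)); rewrite -lD !subrK.
pose lM : {additive A -> N} := HB.pack l (GRing.isZmodMorphism.Build _ _ l lB).
(* If [a *+ 2 = 0], then [0 = q0 (a + a) = q0 a *+ 2 + beta a a], so [l a = beta a a + beta a a =
   beta (a + a) a = 0]. *)
have [a a2|g gP] := @even_part lM.
  have E : beta a a + beta a a = 0.
    by rewrite -bB.1 -mulr2n a2 b0.
  have := q0D a a; rewrite -mulr2n a2 q00 => E'.
  by rewrite /= /l; apply: (eq_lin E); apply: (eq_lin E'); rewrite mulr2n; zmod.
pose q a := q0 a + g a.
have qD a b : q (a + b) = q a + q b + beta a b.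
  by rewrite /q q0D raddfD; zmod.
(* This amounts to evenness, as [0 = q 0 = q a + q (- a) - beta a a]. *)
have q2 a : q a + q a = beta a a.
  by rewrite /q; have := gP a; rewrite /= /l !mulr2n => E;
     apply: (eq_lin (esym E)); zmod.
have q0' : q 0 = 0 by rewrite /q q00 raddf0 addr0.
have qQ : q \in @quad_pred A N.
  apply/asboolP; split=> [a|a b d]; last by rewrite !qD bB.1; zmod.
  have := qD a (- a); rewrite subrr q0' bN -q2 => E.
  by apply: (eq_lin E); zmod.
by exists (MkQuad qQ) => a b; rewrite /polar /= qD; zmod.
Qed.
End PolarSurjective.

(** * The diagram *)

Lemma RmodZ_divisible (R : realType) : divisible (RmodZ R).
Proof.
move=> n x n0; have [r <-] := toRmodZ_surj x.
exists (toRmodZ R (r / n%:R)); rewrite -raddfMn; congr (toRmodZ R _).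
by rewrite -[LHS]mulr_natr divfK // pnatr_eq0 -lt0n.
Qed.

Lemma cls_surj (A N : zmodType) (h : H3ab A N) : exists z, cls z = h.
Proof. by exists (repr h); exact: reprK. Qed.

Section TraceIsomorphism.
Variables (A N : zmodType).
Hypothesis divN : divisible N.

Lemma Tr_inj : injective (Tr : H3ab A N -> Quad A N).
Proof.
apply: raddf_inj => h; have [z <-] := cls_surj h => Tr0.
have z0 : trace_zero (Z3ab_val z).
  by move=> a; rewrite -Tr_cls Tr0.
have [f zf] := divisible_trace_injective divN (asboolP _ (Z3abP z)) z0.
apply/eqP; rewrite -(raddf0 cls) -Quotient.idealrBE subr0.
by apply/asboolP; exists f.
Qed.

Lemma Tr_surj (q : Quad A N) : exists h, Tr h = q.
Proof.
have [p [pZ pq]] := trace_surjective q divN.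
have pZ' : p \in @Z3ab_pred A N by apply/asboolP.
exists (cls (MkZ3ab pZ')); apply: val_inj; apply/funext => a.
exact: (etrans (Tr_cls (MkZ3ab pZ') a) (pq a)).
Qed.

Lemma b_quad_surj (beta : {additive S2 A -> N}) : exists q, b_quad q = beta.
Proof.
have bB : biadditive (fun a b => beta (smul a b)).
  have [sl sr] := smul_biadditive A.
  by split=> a b d; rewrite (sl, sr) raddfD.
have [q qb] := polar_surjective divN bB (fun a b => congr1 beta (smulC a b)).
by exists q; apply: S2_ext => a b; rewrite b_quadE qb.
Qed.
End TraceIsomorphism.

Lemma H3s_of_polar0 (A N : zmodType) (h : H3ab A N) :
  (forall a b, polar (Tr h) a b = 0) -> exists h', H3s_incl h' = h.
Proof.
move=> h0; suff hs : h \in @H3s_pred A N by exists (MkH3s hs).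
have [z zh] := cls_surj h; apply/asboolP; exists z; split=> // x y.
by rewrite -[RHS](h0 x y) -zh /polar !Tr_cls.
Qed.

Section HalfHomomorphisms.
Variables (R : realType) (A : zmodType).

Lemma Hom_incl_inj : injective (Hom_incl : {additive A -> HalfZ R} -> _).
Proof.
move=> f g fg; apply: hom_ext => a; apply: val_inj.
exact: (congr1 (fun q : Quad A (RmodZ R) => q a) fg).
Qed.

Lemma polar_Hom_incl (f : {additive A -> HalfZ R}) a b :
  polar (Hom_incl f) a b = 0.
Proof. by rewrite /polar /= raddfD HalfZ_valD; zmod. Qed.

Lemma Hom_incl_of_polar0 (q : Quad A (RmodZ R)) :
  (forall a b, polar q a b = 0) -> exists f, Hom_incl f = q.
Proof.
move=> q0; have qD a b : q (a + b) = q a + q b.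
  by apply: (eq_lin (q0 a b)); rewrite /polar; zmod.
have q00 : q 0 = 0 by apply: (addrI (q 0)); rewrite -qD !addr0.
have qB a b : q (a - b) = q a - q b by apply: (addIr (q b)); rewrite -qD !subrK.
(* Evenness and additivity give [q a + q a = q (- a) + q a = q 0 = 0]. *)
have qh a : q a \in @half_pred R.
  apply/half_predP; have [qN _] := asboolP _ (quadP q).
  by rewrite {1}qN -qD addNr.
pose f a := MkHalfZ (qh a).
have fB : zmod_morphism f.
  by move=> a b; apply: val_inj; rewrite [RHS]HalfZ_valB /= qB.
exists (HB.pack_for {additive A -> HalfZ R} f (GRing.isZmodMorphism.Build _ _ f fB)).
by apply: val_inj.
Qed.
End HalfHomomorphisms.

Lemma b_quad_eq0 (A N : zmodType) (q : Quad A N) :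
  b_quad q = 0 <-> forall a b, polar q a b = 0.
Proof.
split=> [q0 a b|q0]; first by rewrite -b_quadE q0.
by apply: S2_ext => a b; rewrite b_quadE q0.
Qed.

Theorem proposition5p2 (R : realType) (A : zmodType) :
  [/\ (* the left and right squares commute *)
      (forall h : H3s A (RmodZ R), Hom_incl (Tr_s h) = Tr (H3s_incl h)) /\
      (forall h : H3ab A (RmodZ R),
         b_quad (Tr h) = (idfun : {additive S2 A -> RmodZ R} -> _) (b_H3ab h)),
      (* the vertical homomorphisms are isomorphisms *)
      [/\ bijective (Tr_s : H3s A (RmodZ R) -> {additive A -> HalfZ R}),
          bijective (Tr : H3ab A (RmodZ R) -> Quad A (RmodZ R))
        & bijective (idfun : {additive S2 A -> RmodZ R} ->
                             {additive S2 A -> RmodZ R})],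
      (* the rows are exact *)
      short_exact (@H3s_incl A (RmodZ R)) (@b_H3ab A (RmodZ R))
    & short_exact (@Hom_incl R A) (@b_quad A (RmodZ R))].
Proof.
have divN := @RmodZ_divisible R.
have square (h : H3s A (RmodZ R)) : Hom_incl (Tr_s h) = Tr (H3s_incl h).
  by apply: val_inj; apply/funext.
have incl_inj : injective (@H3s_incl A (RmodZ R)) by exact: val_inj.
have bij (X Y : Type) (f : X -> Y) :
    injective f -> (forall y, exists x, f x = y) -> bijective f.
  move=> f_inj f_surj; pose g y := projT1 (cid (f_surj y)).
  have gK y : f (g y) = y by rewrite /g; case: cid.
  by exists g => // x; apply: f_inj; rewrite gK.
(* [b_H3ab] is [b_quad] after [Tr], so the right square holds by conversion. *)
split; split=> //.
- apply: bij => [h h' hh'|f].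
    by apply/incl_inj/(Tr_inj divN); rewrite -!square hh'.
  have [h hf] := Tr_surj divN (Hom_incl f).
  have [|h' h'h] := @H3s_of_polar0 _ _ h.
    by move=> a b; rewrite hf polar_Hom_incl.
  by exists h'; apply: Hom_incl_inj; rewrite square h'h.
- exact: bij (Tr_inj divN) (Tr_surj divN).
- move=> h; split=> [/b_quad_eq0|[h' <-]]; first exact: H3s_of_polar0.
  by apply/b_quad_eq0; exact: polar_Tr_H3s.
- move=> beta; have [q <-] := b_quad_surj divN beta.
  by have [h <-] := Tr_surj divN q; exists h.
- exact: Hom_incl_inj.
- move=> q; split=> [/b_quad_eq0|[f <-]]; first exact: Hom_incl_of_polar0.
  by apply/b_quad_eq0; exact: polar_Hom_incl.
- exact: b_quad_surj.
Qed.
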